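(* Let $\alpha_1>-1$ and $\alpha_2>-1$ be real numbers, let $D\subset\mathbb{R}^2$ be the unit disk, and let $\Gamma_{\pm}:=\partial D\cap\{(x,y)\in\mathbb{R}^2 : \pm y>0\}$. There exists a (conformal) metric $g$ with constant Gauss curvature on $D$ and with constant geodesic curvature on each of $\Gamma_+$ and $\Gamma_-$, admitting two corners, at $p_1=(1,0)$ with order $\alpha_1$ and at $p_2=(-1,0)$ with order $\alpha_2$, if and only if $\alpha_1=\alpha_2$.
   Context: A conformal metric $ds^2$ on a Riemann surface $\Sigma$ (possibly with boundary) has a conical singularity of order $\alpha$ (a real number with $\alpha>-1$) at a point $p\in\Sigma\cup\partial\Sigma$ if in some neighborhood of $p$ one has $ds^2=e^{2u}|z-z(p)|^{2\alpha}|dz|^2$, where $z$ is a coordinate of $\Sigma$ defined in this neighborhood and $u$ is smooth away from $p$ and continuous at $p$. If $p\in\partial\Sigma$, such a point is called a corner of order $\alpha$ (its angle is $\pi(\alpha+1)$). Away from its conical singularities and corners the metric is a smooth conformal metric, up to and including the boundary. The constant values of the geodesic curvature on $\Gamma_+$ and on $\Gamma_-$ are allowed to be different. *)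

(* Defs.v *)
From Stdlib Require Import Reals.
From Coquelicot Require Import Coquelicot.
Open Scope R_scope.

(* C^infinity near (x, y): partial derivatives of all orders exist and are
   continuous on a neighbourhood of (x, y). *)
Definition smooth_at (f : R -> R -> R) (x y : R) : Prop :=
  locally_2d (fun x' y' => forall n : nat, ex_diff_n f n x' y') x y.

(* The two coordinate directions of the plane, used as tensor indices. *)
Inductive index : Set := I1 | I2.

Definition isum (f : index -> R) : R := f I1 + f I2.

Definition partial (i : index) (f : R -> R -> R) : R -> R -> R :=
  match i with
  | I1 => fun x y => Derive (fun t => f t y) x
  | I2 => fun x y => Derive (fun t => f x t) y
  end.

(* Components g_ij of a (symmetric) metric tensor. *)
Definition metric := index -> index -> R -> R -> R.

Definition metric_det (g : metric) (x y : R) : R :=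
  g I1 I1 x y * g I2 I2 x y - g I1 I2 x y * g I2 I1 x y.

Definition metric_inv (g : metric) : metric := fun i j x y =>
  match i, j with
  | I1, I1 => g I2 I2 x y
  | I2, I2 => g I1 I1 x y
  | _, _ => - g i j x y
  end / metric_det g x y.

(* christoffel g k i j = Gamma^k_ij *)
Definition christoffel (g : metric) (k i j : index) (x y : R) : R :=
  / 2 * isum (fun l => metric_inv g k l x y *
    (partial i (g j l) x y + partial j (g i l) x y - partial l (g i j) x y)).

(* riemann g l k i j = R^l_kij, with R(e_i, e_j) e_k = sum_l R^l_kij e_l *)
Definition riemann (g : metric) (l k i j : index) (x y : R) : R :=
  partial i (christoffel g l j k) x y - partial j (christoffel g l i k) x y
  + isum (fun m => christoffel g l i m x y * christoffel g m j k x y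
                 - christoffel g l j m x y * christoffel g m i k x y).

(* g (R(e_1, e_2) e_2, e_1) / det g *)
Definition gauss_curvature (g : metric) (x y : R) : R :=
  isum (fun l => g I1 l x y * riemann g l I2 I1 I2 x y) / metric_det g x y.

(* c I1 and c I2 are the coordinates of a parametrised curve. *)
Definition curve := index -> R -> R.

Definition covariant_acceleration (g : metric) (c : curve) (k : index) (t : R)
  : R :=
  Derive_n (c k) 2 t
  + isum (fun i => isum (fun j =>
      christoffel g k i j (c I1 t) (c I2 t) * Derive (c i) t * Derive (c j) t)).

Definition speed (g : metric) (c : curve) (t : R) : R :=
  sqrt (isum (fun i => isum (fun j =>
    g i j (c I1 t) (c I2 t) * Derive (c i) t * Derive (c j) t))).

(* Signed with respect to the unit normal on the left of c:
   dA_g (c', nabla_c' c') / |c'|_g ^ 3. *)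
Definition geodesic_curvature (g : metric) (c : curve) (t : R) : R :=
  sqrt (metric_det g (c I1 t) (c I2 t)) *
  (Derive (c I1) t * covariant_acceleration g c I2 t
   - Derive (c I2) t * covariant_acceleration g c I1 t) / speed g c t ^ 3.

(* rho |dz|^2 *)
Definition conformal (rho : R -> R -> R) : metric := fun i j =>
  match i, j with
  | I1, I1 | I2, I2 => rho
  | _, _ => fun _ _ => 0
  end.

Definition disk (x y : R) : Prop := x ^ 2 + y ^ 2 < 1.
Definition closed_disk (x y : R) : Prop := x ^ 2 + y ^ 2 <= 1.
Definition circle (x y : R) : Prop := x ^ 2 + y ^ 2 = 1.
Definition Gamma_plus (x y : R) : Prop := circle x y /\ y > 0.
Definition Gamma_minus (x y : R) : Prop := circle x y /\ - y > 0.

(* Counterclockwise, so the disk lies on the left: the boundary of the flat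
   unit disk has geodesic curvature 1. *)
Definition unit_circle : curve := fun i =>
  match i with I1 => cos | I2 => sin end.

(* rho |dz|^2 is a smooth metric on the closed disk minus (1, 0) and (-1, 0).
   Smoothness up to the boundary means smooth extendability across it;
   rho is such an extension, and its values outside the closed disk are
   otherwise unconstrained. *)
Definition regular_away_from_corners (rho : R -> R -> R) : Prop :=
  forall x y : R, closed_disk x y -> (x, y) <> (1, 0) -> (x, y) <> (-1, 0) ->
    rho x y > 0 /\ smooth_at rho x y.

(* rho = e^(2u) |z - p|^(2 alpha) on the closed disk near p = (a, b), where u is
   smooth away from p and continuous at p as a function on the closed disk. *)
Definition has_corner (rho : R -> R -> R) (a b alpha : R) : Prop :=
  exists u : R -> R -> R,
    locally_2d (fun x y => closed_disk x y -> (x, y) <> (a, b) ->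
      smooth_at u x y /\
      rho x y = exp (2 * u x y) * Rpower (dist_euc x y a b) (2 * alpha)) a b /\
    filterlim (fun q : R * R => u (fst q) (snd q))
      (within (fun q : R * R => closed_disk (fst q) (snd q)) (locally (a, b)))
      (locally (u a b)).

(* Main.v *)
(** Necessity. Pull the metric back by [z = tanh (w / 2)] to
    [exp (2 v) |dw|^2] on the strip [|Im w| <= PI / 2], whose ends correspond
    to the two corners. There [v] solves a Liouville equation with nonlinear
    Neumann conditions that are invariant under translation along the strip, so
    the Hamiltonian
    [int (v_x^2 - v_y^2 + K exp (2 v)) / 2 dy + kp exp v + km exp v]
    (boundary terms taken on the two sides) does not depend on [x]. At the end
    with a corner of order [alpha], [v + (alpha + 1) |x|] has a limit, and a
    convexity argument gives a sequence along which the gradient of this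
    quantity tends to [0] in [L^2]; the Hamiltonian is therefore
    [PI (alpha + 1)^2 / 2]. Comparing both ends gives [alpha1 = alpha2].

    Sufficiency. The spherical bigon of angle [PI (alpha + 1)], bounded by two
    geodesics, has corners of order [alpha] at both vertices. *)

Require Import Defs.
From Stdlib Require Import Reals Lra.
From Coquelicot Require Import Coquelicot.
Open Scope R_scope.

(** * Liouville fields on a strip *)

(** The strip coordinate straightens the one-parameter group of conformal maps of the disk fixing
    both corners; the Hamiltonian is the conserved charge of that symmetry. The obstacle is
    regularity: at a corner [u] is merely continuous, so nothing is known about its derivatives and
    a pointwise limit of the gradient of [v] is not at hand. Because the charge is constant, its
    value at an end can be read along a single sequence on which the gradient is small only in mean
    square. The rate [alpha + 1] has two sources: [|z - p|] is about [2 exp (- |x|)], which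
    contributes [alpha], and so is [|dz/dw|], which contributes [1]. Since [alpha > -1], [v] tends
    to minus infinity, every exponential term disappears at the ends, and the charge sees neither
    [K] nor the two side constants; positivity of [alpha + 1] then recovers it from its square. The
    bigon comes from the developing map [((1 + z) / (1 - z)) ^ beta = exp (beta w)] with
    [beta = alpha + 1]. On the strip its metric is a function of [x] alone, so both sides are
    geodesics. *)

Lemma continuity_2d_pt_exp (f : R -> R -> R) (x y : R) :
  continuity_2d_pt f x y -> continuity_2d_pt (fun u v => exp (f u v)) x y.
Proof.
  intros Hf. apply (continuity_1d_2d_pt_comp exp); [|exact Hf].
  apply derivable_continuous_pt, derivable_pt_exp.
Qed.

Lemma continuity_2d_pt_comp_2d (f g h : R -> R -> R) (x y : R) :
  continuity_2d_pt f (g x y) (h x y) ->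
  continuity_2d_pt g x y -> continuity_2d_pt h x y ->
  continuity_2d_pt (fun u v => f (g u v) (h u v)) x y.
Proof.
  intros Hf Hg Hh eps.
  destruct (Hf eps) as [d Hd].
  generalize (locally_2d_and _ _ _ _ (Hg d) (Hh d)).
  apply locally_2d_impl, locally_2d_forall.
  intros u v [H1 H2]. now apply Hd.
Qed.

Lemma continuity_2d_pt_section (f : R -> R -> R) (x y : R) :
  continuity_2d_pt f x y -> continuous (fun t => f x t) y.
Proof.
  intros Hf. apply continuity_pt_filterlim. intros eps Heps.
  destruct (Hf (mkposreal eps Heps)) as [d Hd].
  exists d; split; [apply cond_pos|].
  intros t [_ Ht]. apply Hd; [|exact Ht].
  replace (x - x) with 0 by ring. rewrite Rabs_R0. apply cond_pos.
Qed.

Definition clamp (a b t : R) : R := Rmax a (Rmin b t).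

Lemma clamp_id (a b t : R) : a <= t <= b -> clamp a b t = t.
Proof.
  intros Ht. unfold clamp. rewrite Rmin_right by lra. apply Rmax_right; lra.
Qed.

Lemma clamp_bounds (a b t : R) : a <= b -> a <= clamp a b t <= b.
Proof.
  intros Hab. unfold clamp. split; [apply Rmax_l|].
  apply Rmax_lub; [exact Hab|apply Rmin_l].
Qed.

Lemma clamp_lipschitz (a b s t : R) :
  Rabs (clamp a b s - clamp a b t) <= Rabs (s - t).
Proof.
  unfold clamp, Rmax, Rmin.
  repeat destruct Rle_dec; unfold Rabs; repeat destruct Rcase_abs; lra.
Qed.

Lemma continuity_2d_pt_clamp (f : R -> R -> R) (a b x t : R) :
  continuity_2d_pt f x (clamp a b t) ->
  continuity_2d_pt (fun u s => f u (clamp a b s)) x t.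
Proof.
  intros Hf. apply (continuity_2d_pt_comp_2d f (fun u _ => u)
    (fun _ s => clamp a b s)); [exact Hf|apply continuity_2d_pt_id1|].
  intros eps. exists eps. intros u s _ Hs.
  eapply Rle_lt_trans; [apply clamp_lipschitz|exact Hs].
Qed.

Definition strip_continuous (a b : R) (f : R -> R -> R) : Prop :=
  forall x y, a <= y <= b -> continuity_2d_pt f x y.

Lemma strip_is_RInt (a b : R) (f : R -> R -> R) (x : R) : a <= b ->
  strip_continuous a b f -> is_RInt (f x) a b (RInt (f x) a b).
Proof.
  intros Hab Hf. apply (RInt_correct (V := R_CompleteNormedModule)).
  apply (ex_RInt_continuous (V := R_CompleteNormedModule)).
  intros y Hy. rewrite Rmin_left, Rmax_right in Hy by exact Hab.
  apply continuity_2d_pt_section, Hf, Hy.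
Qed.

(* Clamping the integration variable removes the need for any information on
   [f] outside of the closed strip. *)
Lemma strip_is_derive_RInt (a b : R) (f f' : R -> R -> R) (x : R) : a <= b ->
  (forall u y, a <= y <= b -> is_derive (fun s => f s y) u (f' u y)) ->
  strip_continuous a b f -> strip_continuous a b f' ->
  is_derive (fun u => RInt (f u) a b) x (RInt (f' x) a b).
Proof.
  intros Hab Hd Hf Hf'.
  pose (g := fun u y => f u (clamp a b y)).
  assert (Hg : forall u y, is_derive (fun s => g s y) u (f' u (clamp a b y))).
  { intros u y. apply Hd, clamp_bounds, Hab. }
  assert (Hmm : forall y, Rmin a b < y < Rmax a b -> a <= y <= b).
  { intros y. rewrite Rmin_left, Rmax_right by exact Hab. lra. }
  apply (is_derive_ext (fun u => RInt (fun y => g u y) a b)).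
  { intros u. apply RInt_ext. intros y Hy. unfold g.
    now rewrite clamp_id by now apply Hmm. }
  replace (RInt (f' x) a b)
    with (RInt (fun y => Derive (fun u => g u y) x) a b).
  2:{ apply RInt_ext. intros y Hy.
      transitivity (f' x (clamp a b y)); [apply is_derive_unique, Hg|].
      now rewrite clamp_id by now apply Hmm. }
  apply is_derive_RInt_param.
  - apply filter_forall. intros u y _. eexists; apply Hg.
  - intros y _. apply continuity_2d_pt_ext with (fun u s => f' u (clamp a b s)).
    + intros u s. symmetry. apply is_derive_unique, Hg.
    + apply continuity_2d_pt_clamp, Hf', clamp_bounds, Hab.
  - apply filter_forall. intros u.
    apply (ex_RInt_ext (f u)).
    + intros y Hy. unfold g. now rewrite clamp_id by now apply Hmm.
    + eexists. now apply strip_is_RInt.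
Qed.

(* [exp (2 v) |dw|^2] has Gauss curvature [K] on the strip, and the upper and
   lower sides have geodesic curvatures [kp] and [km]. *)
Record liouville_strip (a b K kp km : R) (v vx vy vxx vxy vyy : R -> R -> R)
  : Prop := {
  ls_x : forall x y, a <= y <= b -> is_derive (fun t => v t y) x (vx x y);
  ls_y : forall x y, a <= y <= b -> is_derive (fun t => v x t) y (vy x y);
  ls_xx : forall x y, a <= y <= b -> is_derive (fun t => vx t y) x (vxx x y);
  ls_xy : forall x y, a <= y <= b -> is_derive (fun t => vx x t) y (vxy x y);
  ls_yx : forall x y, a <= y <= b -> is_derive (fun t => vy t y) x (vxy x y);
  ls_yy : forall x y, a <= y <= b -> is_derive (fun t => vy x t) y (vyy x y);
  ls_c : strip_continuous a b v;
  ls_cx : strip_continuous a b vx;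
  ls_cy : strip_continuous a b vy;
  ls_cxx : strip_continuous a b vxx;
  ls_cxy : strip_continuous a b vxy;
  ls_cyy : strip_continuous a b vyy;
  ls_curv : forall x y, a < y < b ->
    vxx x y + vyy x y = - K * exp (2 * v x y);
  ls_top : forall x, vy x b = kp * exp (v x b);
  ls_bot : forall x, vy x a = - km * exp (v x a) }.

(* The Hamiltonian of [v_xx = - v_yy - K exp (2 v)], with [x] as time. *)
Definition flux (a b K kp km : R) (v vx vy : R -> R -> R) (x : R) : R :=
  RInt (fun y => vx x y * vx x y / 2 - vy x y * vy x y / 2
                 + K / 2 * exp (2 * v x y)) a b
  + kp * exp (v x b) + km * exp (v x a).

(** Restates an equality at the type [R] itself, where [ring] and [field] recognise it. *)
Ltac req := match goal with |- @eq _ ?x ?y => change (@eq R x y) end.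

Ltac cont2d :=
  unfold strip_continuous, Rdiv, Rminus in *; intros;
  repeat first
    [ assumption
    | apply continuity_2d_pt_const
    | apply continuity_2d_pt_id1
    | apply continuity_2d_pt_id2
    | apply continuity_2d_pt_opp
    | apply continuity_2d_pt_plus
    | apply continuity_2d_pt_mult
    | apply continuity_2d_pt_exp ];
  try first
    [ eapply ls_c; eassumption | eapply ls_cx; eassumption
    | eapply ls_cy; eassumption | eapply ls_cxx; eassumption
    | eapply ls_cxy; eassumption | eapply ls_cyy; eassumption ].

(** By the curvature equation the [x]-derivative of the integrand equals [- (v_x v_y)_y]. Its
    integral is a difference of boundary values, and the Neumann conditions make these cancel the
    derivatives of the two side terms. *)
Lemma flux_derive (a b K kp km : R) (v vx vy vxx vxy vyy : R -> R -> R)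
    (x : R) : a <= b ->
  liouville_strip a b K kp km v vx vy vxx vxy vyy ->
  is_derive (flux a b K kp km v vx vy) x 0.
Proof.
  intros Hab L. unfold flux.
  assert (Ha : a <= a <= b) by lra. assert (Hb : a <= b <= b) by lra.
  pose (g := fun x y => vx x y * vxx x y - vy x y * vxy x y
             + K * vx x y * exp (2 * v x y)).
  assert (Hg : RInt (g x) a b
      = - (vx x b * vy x b) - - (vx x a * vy x a)).
  { apply is_RInt_unique.
    apply (is_RInt_ext (fun y => - (vxy x y * vy x y + vx x y * vyy x y))).
    { intros y. rewrite Rmin_left, Rmax_right by exact Hab. intros Hy.
      unfold g. pose proof (ls_curv _ _ _ _ _ _ _ _ _ _ _ L x y Hy).
      replace (vxx x y) with (- K * exp (2 * v x y) - vyy x y) by lra.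
      req; ring. }
    apply (is_RInt_derive (V := R_CompleteNormedModule)
      (fun y => - (vx x y * vy x y))).
    - intros y. rewrite Rmin_left, Rmax_right by exact Hab. intros Hy.
      apply (is_derive_opp (V := R_NormedModule)).
      apply (is_derive_mult (K := R_AbsRing) (fun y => vx x y)
        (fun y => vy x y)).
      + eapply ls_xy; eassumption.
      + eapply ls_yy; eassumption.
      + intros; apply Rmult_comm.
    - intros y. rewrite Rmin_left, Rmax_right by exact Hab. intros Hy.
      apply (continuity_2d_pt_section
        (fun x y => - (vxy x y * vy x y + vx x y * vyy x y))).
      cont2d. }
  assert (E : 0 = RInt (g x) a b + kp * (vx x b * exp (v x b))
              + km * (vx x a * exp (v x a))).
  { rewrite Hg, (ls_top _ _ _ _ _ _ _ _ _ _ _ L),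
      (ls_bot _ _ _ _ _ _ _ _ _ _ _ L). ring. }
  rewrite E.
  apply (is_derive_plus (V := R_NormedModule)
    (fun x => _ + kp * exp (v x b))).
  apply (is_derive_plus (V := R_NormedModule)).
  - apply (strip_is_derive_RInt a b (fun x y => vx x y * vx x y / 2
      - vy x y * vy x y / 2 + K / 2 * exp (2 * v x y)));
      [exact Hab| |cont2d..].
    intros u y Hy. unfold g.
    pose proof (ls_x _ _ _ _ _ _ _ _ _ _ _ L u y Hy) as D1.
    pose proof (ls_xx _ _ _ _ _ _ _ _ _ _ _ L u y Hy) as D2.
    pose proof (ls_yx _ _ _ _ _ _ _ _ _ _ _ L u y Hy) as D3.
    auto_derive.
    + repeat split; eexists; eassumption.
    + apply is_derive_unique in D1, D2, D3.
      simpl in D1, D2, D3.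
      rewrite D1, D2, D3. field.
  - apply is_derive_scal.
    apply (is_derive_comp (V := R_NormedModule) exp (fun x => v x b)).
    + apply is_derive_exp.
    + eapply ls_x; eassumption.
  - apply is_derive_scal.
    apply (is_derive_comp (V := R_NormedModule) exp (fun x => v x a)).
    + apply is_derive_exp.
    + eapply ls_x; eassumption.
Qed.

(** * The flux at an end of the strip *)

Lemma is_derive_0_constant (f : R -> R) :
  (forall x, is_derive f x 0) -> forall x y, f x = f y.
Proof.
  intros Hf.
  assert (H : forall x y, x < y -> f x = f y).
  { intros x y Hxy. apply (eq_is_derive (V := R_NormedModule) f x y);
      [intros; apply Hf|exact Hxy]. }
  intros x y. destruct (Rtotal_order x y) as [h|[h|h]].
  - now apply H.
  - now subst.
  - symmetry. now apply H.
Qed.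

(** A function with second derivative at least [delta] on a half-line eventually has slope at least
    [1], hence is unbounded there. *)
Lemma bounded_second_derive_lt (P P1 P2 : R -> R) (B x0 delta : R) :
  0 < delta -> (forall x, is_derive P x (P1 x)) ->
  (forall x, is_derive P1 x (P2 x)) ->
  (forall x, x0 <= x -> Rabs (P x) <= B) ->
  exists x, x0 <= x /\ P2 x < delta.
Proof.
  intros Hd D1 D2 HB.
  destruct (Classical_Prop.classic (exists x, x0 <= x /\ P2 x < delta))
    as [H|H]; [exact H|exfalso].
  assert (H2 : forall x, x0 <= x -> delta <= P2 x).
  { intros x Hx. apply Rnot_lt_le. intros h. apply H. now exists x. }
  clear H.
  (* Over the length [x1 - x0] the slope gains at least [|P1 x0| + 1], which lifts it to [1]
     whatever its initial sign. *)
  pose (x1 := x0 + (Rabs (P1 x0) + 1) / delta).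
  assert (Hpos : 0 < (Rabs (P1 x0) + 1) / delta).
  { apply Rdiv_lt_0_compat; [|exact Hd]. pose proof (Rabs_pos (P1 x0)); lra. }
  assert (H1 : forall x, x1 <= x -> 1 <= P1 x).
  { intros x Hx.
    destruct (MVT_gen P1 x0 x P2) as [c [Hc Ec]].
    - intros; apply D2.
    - intros t _. apply derivable_continuous_pt. exists (P2 t).
      apply is_derive_Reals, D2.
    - unfold x1 in Hx. rewrite Rmin_left, Rmax_right in Hc by lra.
      assert (Hm : delta * (x - x0) <= P2 c * (x - x0)).
      { apply Rmult_le_compat_r; [lra|]. apply H2; lra. }
      assert (Hm' : delta * ((Rabs (P1 x0) + 1) / delta) <= delta * (x - x0))
        by (apply Rmult_le_compat_l; lra).
      replace (delta * ((Rabs (P1 x0) + 1) / delta))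
        with (Rabs (P1 x0) + 1) in Hm' by (field; lra).
      pose proof (Rabs_maj2 (P1 x0)). lra. }
  pose proof (HB x0 (Rle_refl _)) as HB0.
  assert (HBp : 0 <= B) by (pose proof (Rabs_pos (P x0)); lra).
  (* With slope at least [1], a length of [2 * B + 1] exceeds the oscillation [2 * B] that the bound
     permits. *)
  destruct (MVT_gen P x1 (x1 + (2 * B + 1)) P1) as [c [Hc Ec]].
  - intros; apply D1.
  - intros t _. apply derivable_continuous_pt. exists (P1 t).
    apply is_derive_Reals, D1.
  - rewrite Rmin_left, Rmax_right in Hc by lra.
    assert (Hm : 1 * (2 * B + 1) <= P1 c * (x1 + (2 * B + 1) - x1)).
    { replace (x1 + (2 * B + 1) - x1) with (2 * B + 1) by ring.
      apply Rmult_le_compat_r; [lra|]. apply H1; lra. }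
    pose proof (HB x1 ltac:(unfold x1; lra)) as B1.
    pose proof (HB (x1 + (2 * B + 1)) ltac:(unfold x1; lra)) as B2.
    apply Rabs_le_between in B1. apply Rabs_le_between in B2. lra.
Qed.

(** Positivity of [beta] drives [v] to minus infinity uniformly in [y], so the curvature and side
    terms become negligible. *)
Lemma strip_asymptotics (a b beta c : R) (v : R -> R -> R) : 0 < beta ->
  (forall eps, 0 < eps -> exists M, forall x y, M <= x -> a <= y <= b ->
     Rabs (v x y + beta * x - c) <= eps) ->
  forall eps, 0 < eps -> exists M, forall x y, M <= x -> a <= y <= b ->
    Rabs (v x y + beta * x - c) <= eps /\ exp (v x y) <= eps.
Proof.
  intros Hb Hv eps Heps.
  destruct (Hv (Rmin eps 1)) as [M HM]; [apply Rmin_glb_lt; lra|].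
  (* Past this point [beta * x >= 2 + c - ln eps], and an error of at most [1] leaves
     [v <= ln eps - 1]. *)
  exists (Rmax M ((2 + c - ln eps) / beta)). intros x y Hx Hy.
  pose proof (Rmax_l M ((2 + c - ln eps) / beta)).
  pose proof (Rmax_r M ((2 + c - ln eps) / beta)).
  specialize (HM x y ltac:(lra) Hy).
  pose proof (Rmin_l eps 1). pose proof (Rmin_r eps 1).
  split; [lra|].
  rewrite <- (exp_ln eps Heps) at 1.
  left. apply exp_increasing.
  assert (Hbx : beta * ((2 + c - ln eps) / beta) <= beta * x)
    by (apply Rmult_le_compat_l; lra).
  replace (beta * ((2 + c - ln eps) / beta)) with (2 + c - ln eps) in Hbx
    by (field; lra).
  apply Rabs_le_between in HM. lra.
Qed.

(** Dirichlet energy, over one cross-section, of the remainder [v + beta x]. *)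
Definition strip_energy (a b beta : R) (vx vy : R -> R -> R) (x : R) : R :=
  RInt (fun y => (vx x y + beta) * (vx x y + beta) + vy x y * vy x y) a b.

Lemma strip_energy_is_RInt (a b K kp km beta : R)
    (v vx vy vxx vxy vyy : R -> R -> R) (x : R) : a <= b ->
  liouville_strip a b K kp km v vx vy vxx vxy vyy ->
  is_RInt (fun y => (vx x y + beta) * (vx x y + beta) + vy x y * vy x y) a b
    (strip_energy a b beta vx vy x).
Proof.
  intros Hab L. apply (strip_is_RInt a b (fun x y =>
    (vx x y + beta) * (vx x y + beta) + vy x y * vy x y)); [exact Hab|cont2d].
Qed.

Lemma is_RInt_lin (a b k l If Ig : R) (f g : R -> R) :
  is_RInt f a b If -> is_RInt g a b Ig ->
  is_RInt (fun y => k * f y + l * g y) a b (k * If + l * Ig).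
Proof.
  intros Hf Hg. apply (is_RInt_plus (V := R_NormedModule)
    (fun y => k * f y) (fun y => l * g y));
    now apply (is_RInt_scal (V := R_NormedModule)).
Qed.

Lemma is_RInt_abs_le_const (f : R -> R) (a b I M : R) : a <= b ->
  is_RInt f a b I -> (forall y, a <= y <= b -> Rabs (f y) <= M) ->
  Rabs I <= (b - a) * M.
Proof.
  intros Hab HI HM.
  exact (norm_RInt_le_const (V := R_NormedModule) f a b I M Hab HM HI).
Qed.

(* With [h = v + beta x - c], integration by parts gives
   [(int h^2)'' = 2 int |grad h|^2 + o(1)], while [int h^2] stays bounded. *)
Lemma strip_energy_liminf (a b K kp km beta c : R)
    (v vx vy vxx vxy vyy : R -> R -> R) : a <= b -> 0 < beta ->
  liouville_strip a b K kp km v vx vy vxx vxy vyy ->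
  (forall eps, 0 < eps -> exists M, forall x y, M <= x -> a <= y <= b ->
     Rabs (v x y + beta * x - c) <= eps) ->
  forall delta M, 0 < delta ->
    exists x, M <= x /\ strip_energy a b beta vx vy x < delta.
Proof.
  intros Hab Hb L Hv delta M Hd.
  assert (Ha : a <= a <= b) by lra. assert (Hb' : a <= b <= b) by lra.
  (* [C * eps] dominates the curvature term and the two side terms. With [2 * C * eps <= delta], a
     second derivative below [delta] forces an energy below [delta]. *)
  pose (C := Rabs K * (b - a) + Rabs kp + Rabs km + 1).
  assert (HC : 1 <= C).
  { unfold C. pose proof (Rabs_pos K). pose proof (Rabs_pos kp).
    pose proof (Rabs_pos km).
    pose proof (Rmult_le_pos (Rabs K) (b - a) ltac:(lra) ltac:(lra)). lra. }
  pose (eps := Rmin 1 (delta / (2 * C))).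
  assert (Heps : 0 < eps).
  { apply Rmin_glb_lt; [lra|]. apply Rdiv_lt_0_compat; lra. }
  assert (Heps1 : eps <= 1) by apply Rmin_l.
  assert (HepsC : 2 * (C * eps) <= delta).
  { assert (eps <= delta / (2 * C)) by apply Rmin_r.
    assert (C * eps <= C * (delta / (2 * C)))
      by (apply Rmult_le_compat_l; lra).
    replace (C * (delta / (2 * C))) with (delta / 2) in H0 by (field; lra).
    lra. }
  destruct (strip_asymptotics a b beta c v Hb Hv eps Heps) as [M0 HM0].
  pose (h := fun x y => v x y + beta * x - c).
  assert (Dh : forall u y, a <= y <= b ->
    is_derive (fun s => h s y) u (vx u y + beta)).
  { intros u y Hy. unfold h.
    pose proof (ls_x _ _ _ _ _ _ _ _ _ _ _ L u y Hy) as D1.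
    auto_derive; [eexists; eassumption|].
    apply is_derive_unique in D1. simpl in D1. rewrite D1. ring. }
  assert (Ch : strip_continuous a b h) by (unfold h; cont2d).
  destruct (bounded_second_derive_lt
    (fun x => RInt (fun y => h x y * h x y) a b)
    (fun x => RInt (fun y => 2 * (h x y * (vx x y + beta))) a b)
    (fun x => RInt (fun y => 2 * ((vx x y + beta) * (vx x y + beta)
                                   + h x y * vxx x y)) a b)
    (b - a) (Rmax M M0) delta Hd) as [x [Hx H2]].
  - intros x. apply (strip_is_derive_RInt a b (fun x y => h x y * h x y)
      (fun x y => 2 * (h x y * (vx x y + beta)))); [exact Hab| |cont2d..].
    intros u y Hy. pose proof (Dh u y Hy) as D1.
    auto_derive; [repeat split; eexists; eassumption|].
    apply is_derive_unique in D1. simpl in D1. rewrite D1. ring.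
  - intros x. apply (strip_is_derive_RInt a b
      (fun x y => 2 * (h x y * (vx x y + beta)))
      (fun x y => 2 * ((vx x y + beta) * (vx x y + beta)
                       + h x y * vxx x y))); [exact Hab| |cont2d..].
    intros u y Hy. pose proof (Dh u y Hy) as D1.
    pose proof (ls_xx _ _ _ _ _ _ _ _ _ _ _ L u y Hy) as D2.
    auto_derive; [repeat split; eexists; eassumption|].
    apply is_derive_unique in D1, D2. simpl in D1, D2. rewrite D1, D2. ring.
  - intros x Hx. pose proof (Rmax_r M M0).
    replace (b - a) with ((b - a) * 1) by ring.
    apply (is_RInt_abs_le_const (fun y => h x y * h x y)); [exact Hab| |].
    + apply (strip_is_RInt a b (fun x y => h x y * h x y)); [exact Hab|cont2d].
    + intros y Hy. destruct (HM0 x y ltac:(lra) Hy) as [H1 _].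
      fold (h x y) in H1. rewrite Rabs_mult.
      replace 1 with (1 * 1) by ring.
      apply Rmult_le_compat; try apply Rabs_pos; lra.
  - exists x. pose proof (Rmax_l M M0). pose proof (Rmax_r M M0).
    split; [lra|].
    assert (He : forall y, a <= y <= b ->
      Rabs (h x y) <= eps /\ 0 < exp (v x y) <= eps).
    { intros y Hy. pose proof (exp_pos (v x y)).
      destruct (HM0 x y ltac:(lra) Hy). unfold h. lra. }
    clear HM0.
    pose (J := RInt (fun y => h x y * exp (2 * v x y)) a b).
    assert (HJ : is_RInt (fun y => h x y * exp (2 * v x y)) a b J).
    { apply (strip_is_RInt a b (fun x y => h x y * exp (2 * v x y)));
        [exact Hab|cont2d]. }
    assert (HJb : Rabs J <= (b - a) * eps).
    { apply (is_RInt_abs_le_const _ _ _ _ _ Hab HJ).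
      intros y Hy. destruct (He y Hy) as [He1 He2].
      replace (2 * v x y) with (v x y + v x y) by ring.
      rewrite exp_plus, Rabs_mult.
      rewrite (Rabs_right (exp (v x y) * exp (v x y))) by nra.
      replace eps with (eps * (1 * 1)) by ring.
      apply Rmult_le_compat; [apply Rabs_pos|nra|lra|].
      apply Rmult_le_compat; lra. }
    (* The equation replaces [h v_xx] by [- K h exp (2 v) - h v_yy]; integrating [(h v_y)_y] trades
       [- h v_yy] for [v_y ^ 2] plus side values, which the Neumann conditions express through
       [exp v]. *)
    assert (HB : is_RInt (fun y => vy x y * vy x y + h x y * vyy x y) a b
      (h x b * vy x b - h x a * vy x a)).
    { apply (is_RInt_derive (V := R_CompleteNormedModule)
        (fun y => h x y * vy x y)).
      - intros y. rewrite Rmin_left, Rmax_right by exact Hab. intros Hy.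
        apply (is_derive_mult (K := R_AbsRing) (fun y => h x y)
          (fun y => vy x y)).
        + pose proof (ls_y _ _ _ _ _ _ _ _ _ _ _ L x y Hy) as D1.
          unfold h. auto_derive; [eexists; eassumption|].
          apply is_derive_unique in D1. simpl in D1. rewrite D1. ring.
        + eapply ls_yy; eassumption.
        + intros; apply Rmult_comm.
      - intros y. rewrite Rmin_left, Rmax_right by exact Hab. intros Hy.
        apply (continuity_2d_pt_section
          (fun x y => vy x y * vy x y + h x y * vyy x y)). cont2d. }
    pose proof (strip_energy_is_RInt a b K kp km beta _ _ _ _ _ _ x Hab L)
      as HE.
    pose proof (is_RInt_lin a b 2 1 _ _ _ _ HE
      (is_RInt_lin a b (- 2 * K) (- 2) _ _ _ _ HJ HB)) as HS.
    apply (is_RInt_unique (V := R_CompleteNormedModule)) in HS; simpl in HS.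
    rewrite (ls_top _ _ _ _ _ _ _ _ _ _ _ L),
      (ls_bot _ _ _ _ _ _ _ _ _ _ _ L) in HS.
    assert (HP2 : RInt (fun y => 2 * ((vx x y + beta) * (vx x y + beta)
                                   + h x y * vxx x y)) a b
      = 2 * strip_energy a b beta vx vy x + 1 * (- 2 * K * J + - 2 *
          (h x b * (kp * exp (v x b)) - h x a * (- km * exp (v x a))))).
    { rewrite <- HS. apply RInt_ext. intros y.
      rewrite Rmin_left, Rmax_right by exact Hab. intros Hy.
      pose proof (ls_curv _ _ _ _ _ _ _ _ _ _ _ L x y Hy).
      replace (vxx x y) with (- K * exp (2 * v x y) - vyy x y) by lra.
      req; ring. }
    rewrite HP2 in H2.
    assert (HK : Rabs (K * J) <= Rabs K * (b - a) * eps).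
    { rewrite Rabs_mult, Rmult_assoc.
      apply Rmult_le_compat_l; [apply Rabs_pos|exact HJb]. }
    assert (Hk : forall k y, a <= y <= b ->
      Rabs (h x y * (k * exp (v x y))) <= Rabs k * eps).
    { intros k y Hy. destruct (He y Hy) as [He1 He2].
      rewrite !Rabs_mult, (Rabs_right (exp (v x y))) by lra.
      replace (Rabs k * eps) with (1 * (Rabs k * eps)) by ring.
      pose proof (Rabs_pos k).
      apply Rmult_le_compat; [apply Rabs_pos| |lra|].
      - apply Rmult_le_pos; lra.
      - apply Rmult_le_compat_l; lra. }
    pose proof (Hk kp b Hb') as Hk1. pose proof (Hk km a Ha) as Hk2.
    apply Rabs_le_between in HK, Hk1, Hk2.
    unfold C in HepsC. nra.
Qed.

(** The flux at [x0] equals the flux at any point of the sequence of small energy. There [v_x] is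
    close to [- beta] and [v_y] to [0] in mean square and all exponentials are small, so the flux
    lies within [D * z] of the claimed value for every [z > 0]. *)
Lemma flux_at_infinity (a b K kp km beta c : R)
    (v vx vy vxx vxy vyy : R -> R -> R) : a <= b -> 0 < beta ->
  liouville_strip a b K kp km v vx vy vxx vxy vyy ->
  (forall eps, 0 < eps -> exists M, forall x y, M <= x -> a <= y <= b ->
     Rabs (v x y + beta * x - c) <= eps) ->
  forall x, flux a b K kp km v vx vy x = (b - a) * (beta * beta / 2).
Proof.
  intros Hab Hb L Hv x0.
  assert (Ha : a <= a <= b) by lra. assert (Hb' : a <= b <= b) by lra.
  pose (D := 1 + (b - a) * (1 + Rabs K) + Rabs kp + Rabs km).
  assert (HD : 1 <= D).
  { unfold D. pose proof (Rabs_pos K). pose proof (Rabs_pos kp).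
    pose proof (Rabs_pos km).
    pose proof (Rmult_le_pos (b - a) (1 + Rabs K) ltac:(lra) ltac:(lra)).
    lra. }
  set (F0 := flux a b K kp km v vx vy x0).
  set (Lm := (b - a) * (beta * beta / 2)).
  assert (HF : forall z, 0 < z -> Rabs (F0 - Lm) <= D * z).
  { intros z Hz.
    destruct (strip_asymptotics a b beta c v Hb Hv (Rmin 1 z)) as [M HM];
      [apply Rmin_glb_lt; lra|].
    (* With [p = v_x + beta], the integrand contains [p ^ 2 / 2 - beta p]: the [/ 2] accounts for
       the square, the other summand for splitting the cross term at the price of an additive [z].
       The energy is then asked to be below [z / C]. *)
    pose (C := / 2 + beta * beta / (4 * z)).
    assert (HC : 0 < C).
    { unfold C. apply Rplus_lt_0_compat; [lra|].
      apply Rdiv_lt_0_compat; [now apply Rmult_lt_0_compat|lra]. }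
    destruct (strip_energy_liminf a b K kp km beta c _ _ _ _ _ _ Hab Hb L Hv
      (z / C) M ltac:(now apply Rdiv_lt_0_compat)) as [x [Hx HE]].
    assert (HCE : C * strip_energy a b beta vx vy x <= z).
    { replace z with (C * (z / C)) by (field; lra).
      apply Rmult_le_compat_l; lra. }
    replace F0 with (flux a b K kp km v vx vy x)
      by (apply is_derive_0_constant; intros; eapply flux_derive; eassumption).
    assert (He : forall y, a <= y <= b -> 0 < exp (v x y) <= z /\
      0 < exp (2 * v x y) <= z).
    { intros y Hy. pose proof (exp_pos (v x y)).
      destruct (HM x y Hx Hy) as [_ He].
      pose proof (Rmin_l 1 z). pose proof (Rmin_r 1 z).
      replace (2 * v x y) with (v x y + v x y) by ring.
      rewrite exp_plus. split; [lra|]. nra. }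
    unfold flux.
    set (I := RInt _ a b).
    assert (HI : is_RInt (fun y => vx x y * vx x y / 2 - vy x y * vy x y / 2
                 + K / 2 * exp (2 * v x y)) a b I).
    { apply (strip_is_RInt a b (fun x y => vx x y * vx x y / 2
        - vy x y * vy x y / 2 + K / 2 * exp (2 * v x y)));
        [exact Hab|cont2d]. }
    pose proof (strip_energy_is_RInt a b K kp km beta _ _ _ _ _ _ x Hab L)
      as HEi.
    (* [s = 1] and [s = -1] give integrable upper and lower barriers around [beta * beta / 2]. *)
    assert (HW : forall s, is_RInt (fun y => beta * beta / 2 * 1
       + s * (C * ((vx x y + beta) * (vx x y + beta) + vy x y * vy x y)
              + (z + Rabs K * z) * 1)) a b
       (beta * beta / 2 * (b - a) + s * (C * strip_energy a b beta vx vy x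
              + (z + Rabs K * z) * (b - a)))).
    { intros s.
      assert (H1 : is_RInt (fun _ : R => 1) a b (b - a)).
      { replace (b - a) with ((b - a) * 1) by ring.
        apply (is_RInt_const (V := R_NormedModule)). }
      apply is_RInt_lin; [exact H1|]. now apply is_RInt_lin. }
    assert (Hpt : forall y, a < y < b ->
      Rabs (vx x y * vx x y / 2 - vy x y * vy x y / 2
                 + K / 2 * exp (2 * v x y) - beta * beta / 2)
      <= C * ((vx x y + beta) * (vx x y + beta) + vy x y * vy x y)
              + (z + Rabs K * z)).
    { intros y Hy. destruct (He y ltac:(lra)) as [_ He2].
      assert (HK : Rabs (K / 2 * exp (2 * v x y)) <= Rabs K * z).
      { unfold Rdiv. rewrite !Rabs_mult, (Rabs_right (/ 2)) by lra.
        rewrite (Rabs_right (exp _)) by lra.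
        rewrite Rmult_assoc. apply Rmult_le_compat_l; [apply Rabs_pos|lra]. }
      set (p := vx x y + beta). replace (vx x y) with (p - beta)
        by (unfold p; ring).
      set (q := vy x y). unfold C.
      (* AM-GM: [beta |p| <= z + beta^2 p^2 / (4 z)] *)
      assert (Hp : 0 <= z + beta * beta / (4 * z) * (p * p) - beta * p).
      { replace (z + beta * beta / (4 * z) * (p * p) - beta * p)
          with (/ z * ((z - beta * p / 2) * (z - beta * p / 2)))
          by (field; lra).
        apply Rmult_le_pos; [left; now apply Rinv_0_lt_compat|].
        apply Rle_0_sqr. }
      assert (Hp' : 0 <= z + beta * beta / (4 * z) * (p * p) + beta * p).
      { replace (z + beta * beta / (4 * z) * (p * p) + beta * p)
          with (/ z * ((z + beta * p / 2) * (z + beta * p / 2)))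
          by (field; lra).
        apply Rmult_le_pos; [left; now apply Rinv_0_lt_compat|].
        apply Rle_0_sqr. }
      assert (Hq : 0 <= beta * beta / (4 * z) * (q * q)).
      { apply Rmult_le_pos; [|apply Rle_0_sqr].
        left. apply Rdiv_lt_0_compat; [now apply Rmult_lt_0_compat|lra]. }
      assert (0 <= p * p) by apply Rle_0_sqr.
      assert (0 <= q * q) by apply Rle_0_sqr.
      apply Rabs_le_between in HK. apply Rabs_le_between. lra. }
    assert (Hup := is_RInt_le _ _ a b _ _ Hab HI (HW 1)).
    assert (Hlo := is_RInt_le _ _ a b _ _ Hab (HW (-1)) HI).
    lapply Hup; [clear Hup; intros Hup|].
    2:{ intros y Hy. specialize (Hpt y Hy).
        apply Rabs_le_between in Hpt. lra. }
    lapply Hlo; [clear Hlo; intros Hlo|].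
    2:{ intros y Hy. specialize (Hpt y Hy).
        apply Rabs_le_between in Hpt. lra. }
    assert (Hk : forall k y, a <= y <= b ->
      Rabs (k * exp (v x y)) <= Rabs k * z).
    { intros k y Hy. destruct (He y Hy) as [He1 _].
      rewrite Rabs_mult, (Rabs_right (exp (v x y))) by lra.
      apply Rmult_le_compat_l; [apply Rabs_pos|lra]. }
    pose proof (Hk kp b Hb') as Hk1. pose proof (Hk km a Ha) as Hk2.
    apply Rabs_le_between in Hk1, Hk2. apply Rabs_le_between.
    unfold D, Lm. lra. }
  destruct (Req_dec F0 Lm) as [h|h]; [exact h|exfalso].
  assert (Hpos : 0 < Rabs (F0 - Lm)) by (apply Rabs_pos_lt; lra).
  specialize (HF (Rabs (F0 - Lm) / (2 * D))
    ltac:(apply Rdiv_lt_0_compat; lra)).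
  replace (D * (Rabs (F0 - Lm) / (2 * D))) with (Rabs (F0 - Lm) / 2) in HF
    by (field; lra).
  lra.
Qed.

(** Carries the end at minus infinity to plus infinity while leaving the two sides in place, so [kp]
    and [km] are not exchanged. *)
Lemma liouville_strip_reflect (a b K kp km : R)
    (v vx vy vxx vxy vyy : R -> R -> R) :
  liouville_strip a b K kp km v vx vy vxx vxy vyy ->
  liouville_strip a b K kp km (fun x => v (- x)) (fun x y => - vx (- x) y)
    (fun x => vy (- x)) (fun x => vxx (- x)) (fun x y => - vxy (- x) y)
    (fun x => vyy (- x)).
Proof.
  intros L.
  assert (Hd : forall (f : R -> R) (x l : R),
    is_derive f (- x) l -> is_derive (fun t => f (- t)) x (- l)).
  { intros f x l H. replace (- l) with (scal (- 1) l)
      by (unfold scal; simpl; unfold mult; simpl; ring).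
    apply (is_derive_comp (V := R_NormedModule) f (fun t => - t) x);
      [exact H|].
    auto_derive; [exact I|ring]. }
  assert (Hc : forall f, strip_continuous a b f ->
    strip_continuous a b (fun x => f (- x))).
  { intros f Hf x y Hy.
    apply (continuity_2d_pt_comp_2d f (fun x _ => - x) (fun _ y => y));
      [now apply Hf| |]; cont2d. }
  assert (Hn : forall f, strip_continuous a b f ->
    strip_continuous a b (fun x y => - f (- x) y)).
  { intros f Hf x y Hy. apply continuity_2d_pt_opp.
    now apply (Hc f Hf). }
  destruct L. constructor; auto.
  - intros x y Hy. apply (Hd (fun x => v x y)). auto.
  - intros x y Hy. rewrite <- (Ropp_involutive (vxx (- x) y)).
    apply (is_derive_opp (V := R_NormedModule) (fun t => vx (- t) y)).
    apply (Hd (fun x => vx x y)). auto.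
  - intros x y Hy.
    apply (is_derive_opp (V := R_NormedModule) (fun t => vx (- x) t)). auto.
  - intros x y Hy. apply (Hd (fun x => vy x y)). auto.
Qed.

(** In the flux [v_x] occurs only squared, so at [x = 0] the field and its reflection have the same
    flux. Both ends therefore give the same square. *)
Lemma liouville_strip_exponents (a b K kp km beta1 beta2 c1 c2 : R)
    (v vx vy vxx vxy vyy : R -> R -> R) : a < b -> 0 < beta1 -> 0 < beta2 ->
  liouville_strip a b K kp km v vx vy vxx vxy vyy ->
  (forall eps, 0 < eps -> exists M, forall x y, M <= x -> a <= y <= b ->
     Rabs (v x y + beta1 * x - c1) <= eps) ->
  (forall eps, 0 < eps -> exists M, forall x y, M <= x -> a <= y <= b ->
     Rabs (v (- x) y + beta2 * x - c2) <= eps) ->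
  beta1 = beta2.
Proof.
  intros Hab Hb1 Hb2 L H1 H2.
  pose proof (flux_at_infinity a b K kp km beta1 c1 _ _ _ _ _ _
    (Rlt_le _ _ Hab) Hb1 L H1 0) as F1.
  pose proof (flux_at_infinity a b K kp km beta2 c2 _ _ _ _ _ _
    (Rlt_le _ _ Hab) Hb2 (liouville_strip_reflect _ _ _ _ _ _ _ _ _ _ _ L)
    H2 0) as F2.
  assert (E : (b - a) * (beta1 * beta1 / 2) = (b - a) * (beta2 * beta2 / 2)).
  { rewrite <- F1, <- F2. unfold flux. rewrite Ropp_0. f_equal. f_equal.
    apply RInt_ext. intros y _. req; field. }
  apply Rmult_eq_reg_l in E; [|lra]. nra.
Qed.

(** * Curvature of conformal metrics *)

Lemma smooth_at_locally (f : R -> R -> R) (x y : R) :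
  smooth_at f x y -> locally_2d (smooth_at f) x y.
Proof.
  intros H. apply locally_2d_locally in H. apply locally_locally in H.
  apply locally_2d_locally. revert H. apply filter_imp.
  intros [u v] H. now apply locally_2d_locally.
Qed.

Lemma smooth_at_continuity (f : R -> R -> R) (x y : R) :
  smooth_at f x y -> continuity_2d_pt f x y.
Proof.
  intros H. apply locally_2d_singleton in H. exact (proj1 (H 0%nat)).
Qed.

Lemma smooth_at_partial (i : index) (f : R -> R -> R) (x y : R) :
  smooth_at f x y -> smooth_at (partial i f) x y.
Proof.
  apply locally_2d_impl, locally_2d_forall. intros u v H n.
  destruct i.
  - apply ex_diff_n_deriv_aux1, H.
  - apply ex_diff_n_deriv_aux2, H.
Qed.

Lemma smooth_at_is_derive1 (f : R -> R -> R) (x y : R) :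
  smooth_at f x y -> is_derive (fun t => f t y) x (partial I1 f x y).
Proof.
  intros H. apply locally_2d_singleton in H. specialize (H 1%nat).
  apply Derive_correct, H.
Qed.

Lemma smooth_at_is_derive2 (f : R -> R -> R) (x y : R) :
  smooth_at f x y -> is_derive (fun t => f x t) y (partial I2 f x y).
Proof.
  intros H. apply locally_2d_singleton in H. specialize (H 1%nat).
  apply Derive_correct, H.
Qed.

Lemma smooth_at_differentiable (f : R -> R -> R) (x y : R) :
  smooth_at f x y ->
  differentiable_pt_lim f x y (partial I1 f x y) (partial I2 f x y).
Proof.
  intros H. apply filterdiff_differentiable_pt_lim.
  apply (is_derive_filterdiff f x y (partial I1 f) (partial I2 f x y)).
  - apply smooth_at_locally, locally_2d_locally in H. revert H.
    apply filter_imp. intros [u v] H. now apply smooth_at_is_derive1.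
  - now apply smooth_at_is_derive2.
  - apply continuity_2d_pt_filterlim.
    now apply (smooth_at_continuity (partial I1 f)), smooth_at_partial.
Qed.

Lemma smooth_at_partial_comm (f : R -> R -> R) (x y : R) :
  smooth_at f x y ->
  partial I1 (partial I2 f) x y = partial I2 (partial I1 f) x y.
Proof.
  intros H. apply Schwarz.
  - apply smooth_at_locally in H. revert H.
    apply locally_2d_impl, locally_2d_forall. intros u v H.
    repeat split.
    + eexists. now apply smooth_at_is_derive1.
    + eexists. now apply smooth_at_is_derive2.
    + exact (ex_intro _ _ (smooth_at_is_derive1 (partial I2 f) u v
        (smooth_at_partial I2 f u v H))).
    + exact (ex_intro _ _ (smooth_at_is_derive2 (partial I1 f) u v
        (smooth_at_partial I1 f u v H))).
  - apply (smooth_at_continuity (partial I1 (partial I2 f))).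
    now apply smooth_at_partial, smooth_at_partial.
  - apply (smooth_at_continuity (partial I2 (partial I1 f))).
    now apply smooth_at_partial, smooth_at_partial.
Qed.

Lemma smooth_at_chain (f : R -> R -> R) (g h : R -> R) (t g' h' : R) :
  smooth_at f (g t) (h t) -> is_derive g t g' -> is_derive h t h' ->
  is_derive (fun s => f (g s) (h s)) t
    (partial I1 f (g t) (h t) * g' + partial I2 f (g t) (h t) * h').
Proof.
  intros Hf Hg Hh. apply is_derive_Reals.
  apply derivable_pt_lim_comp_2d.
  - now apply smooth_at_differentiable.
  - now apply is_derive_Reals.
  - now apply is_derive_Reals.
Qed.

(** With [r = exp (2 phi)], the quotient [partial i r / (2 r)] is the derivative [phi_i], and these
    are the classical symbols [delta_ki phi_j + delta_kj phi_i - delta_ij phi_k]. *)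
Definition conformal_christoffel (r : R -> R -> R) (k i j : index) (x y : R)
  : R :=
  match k, i, j with
  | I1, I1, I1 | I2, I1, I2 | I2, I2, I1 => partial I1 r x y / (2 * r x y)
  | I2, I2, I2 | I1, I1, I2 | I1, I2, I1 => partial I2 r x y / (2 * r x y)
  | I1, I2, I2 => - partial I1 r x y / (2 * r x y)
  | I2, I1, I1 => - partial I2 r x y / (2 * r x y)
  end.

Lemma christoffel_conformal (r : R -> R -> R) (k i j : index) (x y : R) :
  r x y <> 0 ->
  christoffel (conformal r) k i j x y = conformal_christoffel r k i j x y.
Proof.
  intros Hr.
  assert (H0 : forall i, partial i (fun _ _ => 0) x y = 0).
  { intros []; [apply (Derive_const 0 x)|apply (Derive_const 0 y)]. }
  unfold christoffel, isum, metric_inv, metric_det.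
  destruct k, i, j; cbn [conformal conformal_christoffel]; rewrite ?H0;
    field; exact Hr.
Qed.

(** The right-hand side is [- Laplacian (ln r) / (2 r)] written out. *)
Lemma gauss_curvature_conformal (r : R -> R -> R) (x y : R) :
  smooth_at r x y -> 0 < r x y ->
  gauss_curvature (conformal r) x y
  = - (partial I1 (partial I1 r) x y + partial I2 (partial I2 r) x y)
      / (2 * r x y ^ 2)
    + (partial I1 r x y ^ 2 + partial I2 r x y ^ 2) / (2 * r x y ^ 3).
Proof.
  intros Hs Hr.
  (* The curvature differentiates the symbols, so their closed form is needed on a neighbourhood and
     not just at the point. *)
  assert (Hl : locally_2d (fun u v => r u v <> 0) x y).
  { apply continuity_2d_pt_neq_0; [now apply smooth_at_continuity|lra]. }
  (* The metric being diagonal, only the component [R^1_212] survives, and it differentiates just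
     [Gamma^1_22] in [x] and [Gamma^1_12] in [y]. *)
  assert (D1 : is_derive (fun t => christoffel (conformal r) I1 I2 I2 t y) x
    (- (partial I1 (partial I1 r) x y * r x y - partial I1 r x y ^ 2)
       / (2 * r x y ^ 2))).
  { apply (is_derive_ext_loc
      (fun t => conformal_christoffel r I1 I2 I2 t y)).
    - apply locally_2d_1d_const_y in Hl. revert Hl. apply filter_imp.
      intros t Ht. symmetry. now apply christoffel_conformal.
    - cbn [conformal_christoffel].
      pose proof (smooth_at_is_derive1 _ _ _ Hs) as E1.
      pose proof (smooth_at_is_derive1 _ _ _ (smooth_at_partial I1 _ _ _ Hs))
        as E2.
      set (r1 := partial I1 r) in *.
      set (r11 := partial I1 r1 x y) in *.
      clearbody r11. clearbody r1.
      auto_derive.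
      + repeat split; try (eexists; eassumption). lra.
      + apply is_derive_unique in E1, E2. simpl in E1, E2.
        rewrite E1, E2. field. lra. }
  assert (D2 : is_derive (fun t => christoffel (conformal r) I1 I1 I2 x t) y
    ((partial I2 (partial I2 r) x y * r x y - partial I2 r x y ^ 2)
       / (2 * r x y ^ 2))).
  { apply (is_derive_ext_loc
      (fun t => conformal_christoffel r I1 I1 I2 x t)).
    - apply locally_2d_1d_const_x in Hl. revert Hl. apply filter_imp.
      intros t Ht. symmetry. now apply christoffel_conformal.
    - cbn [conformal_christoffel].
      pose proof (smooth_at_is_derive2 _ _ _ Hs) as E1.
      pose proof (smooth_at_is_derive2 _ _ _ (smooth_at_partial I2 _ _ _ Hs))
        as E2.
      set (r2 := partial I2 r) in *.
      set (r22 := partial I2 r2 x y) in *.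
      clearbody r22. clearbody r2.
      auto_derive.
      + repeat split; try (eexists; eassumption). lra.
      + apply is_derive_unique in E1, E2. simpl in E1, E2.
        rewrite E1, E2. field. lra. }
  apply is_derive_unique in D1, D2.
  match type of D1 with _ = ?l =>
    change (partial I1 (christoffel (conformal r) I1 I2 I2) x y = l) in D1 end.
  match type of D2 with _ = ?l =>
    change (partial I2 (christoffel (conformal r) I1 I1 I2) x y = l) in D2 end.
  unfold gauss_curvature, isum, riemann, isum.
  rewrite D1, D2, !christoffel_conformal by lra.
  unfold metric_det. cbn [conformal conformal_christoffel].
  field. lra.
Qed.

(** Conformal change of geodesic curvature: to the flat value [1] is added the outward normal
    derivative of [ln r / 2], and lengths are scaled by [sqrt r]. *)
Lemma geodesic_curvature_unit_circle (r : R -> R -> R) (t : R) :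
  0 < r (cos t) (sin t) ->
  geodesic_curvature (conformal r) unit_circle t
  = (1 + (partial I1 r (cos t) (sin t) * cos t
          + partial I2 r (cos t) (sin t) * sin t) / (2 * r (cos t) (sin t)))
    / sqrt (r (cos t) (sin t)).
Proof.
  intros Hr.
  assert (Dc : forall t, Derive cos t = - sin t).
  { intros s. apply is_derive_unique, is_derive_cos. }
  assert (Ds : forall t, Derive sin t = cos t).
  { intros s. apply is_derive_unique, is_derive_sin. }
  assert (Dc2 : Derive_n cos 2 t = - cos t).
  { transitivity (Derive (fun s => - sin s) t); [apply Derive_ext, Dc|].
    now rewrite Derive_opp, Ds. }
  assert (Ds2 : Derive_n sin 2 t = - sin t).
  { transitivity (Derive cos t); [apply Derive_ext, Ds|apply Dc]. }
  unfold geodesic_curvature, speed, covariant_acceleration, isum.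
  cbn [unit_circle].
  rewrite Dc, Ds, Dc2, Ds2, !christoffel_conformal by lra.
  unfold metric_det. cbn [conformal conformal_christoffel].
  set (c := cos t). set (s := sin t).
  assert (E : s * s = 1 - c * c).
  { pose proof (sin2_cos2 t) as E. unfold Rsqr in E. fold s c in E. lra. }
  fold s c in Hr.
  set (r0 := r c s) in *. set (r1 := partial I1 r c s).
  set (r2 := partial I2 r c s).
  replace (r0 * r0 - 0 * 0) with (r0 * r0) by ring.
  rewrite (sqrt_square r0) by lra.
  replace (r0 * - s * - s + 0 * - s * c + (0 * c * - s + r0 * c * c))
    with r0 by (ring [E]).
  assert (Hq : sqrt r0 * sqrt r0 = r0) by (apply sqrt_sqrt; lra).
  assert (Hp : 0 < sqrt r0) by now apply sqrt_lt_R0.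
  replace (sqrt r0 ^ 3) with (r0 * sqrt r0) by (rewrite <- Hq at 1; ring).
  field_simplify_eq; [|split; lra]. ring [E].
Qed.

(** * From the disk to the strip *)

Lemma is_derive_cosh (x : R) : is_derive cosh x (sinh x).
Proof. apply is_derive_Reals, derivable_pt_lim_cosh. Qed.

Lemma is_derive_sinh (x : R) : is_derive sinh x (cosh x).
Proof. apply is_derive_Reals, derivable_pt_lim_sinh. Qed.

Lemma sinh_sqr (x : R) : sinh x * sinh x = cosh x * cosh x - 1.
Proof.
  unfold sinh, cosh. assert (E : exp x * exp (- x) = 1).
  { rewrite <- exp_plus, Rplus_opp_r. apply exp_0. }
  field_simplify. replace (exp x * exp (- x)) with 1 by lra.
  nra.
Qed.

Lemma cosh_ge_1 (x : R) : 1 <= cosh x.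
Proof.
  pose proof (sinh_sqr x). assert (0 < cosh x).
  { unfold cosh. pose proof (exp_pos x). pose proof (exp_pos (- x)). lra. }
  nra.
Qed.

Lemma sin_sqr (y : R) : sin y * sin y = 1 - cos y * cos y.
Proof. pose proof (sin2_cos2 y) as E. unfold Rsqr in E. lra. Qed.

Lemma continuity_2d_pt_derivable1 (f f' : R -> R) (x y : R) :
  (forall t, is_derive f t (f' t)) -> continuity_2d_pt (fun u _ => f u) x y.
Proof.
  intros H. apply (continuity_1d_2d_pt_comp f (fun u _ => u));
    [|apply continuity_2d_pt_id1].
  apply derivable_continuous_pt. exists (f' x). apply is_derive_Reals, H.
Qed.

Lemma continuity_2d_pt_derivable2 (f f' : R -> R) (x y : R) :
  (forall t, is_derive f t (f' t)) -> continuity_2d_pt (fun _ v => f v) x y.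
Proof.
  intros H. apply (continuity_1d_2d_pt_comp f (fun _ v => v));
    [|apply continuity_2d_pt_id2].
  apply derivable_continuous_pt. exists (f' y). apply is_derive_Reals, H.
Qed.

Lemma continuity_2d_pt_ln (f : R -> R -> R) (x y : R) :
  continuity_2d_pt f x y -> 0 < f x y ->
  continuity_2d_pt (fun u v => ln (f u v)) x y.
Proof.
  intros Hf Hp. apply (continuity_1d_2d_pt_comp ln); [|exact Hf].
  apply derivable_continuous_pt. exists (/ f x y).
  now apply derivable_pt_lim_ln.
Qed.

(* [z = tanh (w / 2)] maps the strip [|Im w| <= PI / 2] onto the closed disk
   minus its two corners: with [w = x + i y], [z = sx x y + i sy x y], [dz/dw =
   jr x y - i ji x y] and [d^2z/dw^2 = hr x y - i hi x y]. *)
Definition sq (x y : R) : R := cosh x + cos y.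
Definition sx (x y : R) : R := sinh x / sq x y.
Definition sy (x y : R) : R := sin y / sq x y.
Definition jr (x y : R) : R := (1 + cosh x * cos y) / sq x y ^ 2.
Definition ji (x y : R) : R := sinh x * sin y / sq x y ^ 2.
Definition hr (x y : R) : R :=
  - (sinh x * (cos y * sq x y + 2 * sin y ^ 2)) / sq x y ^ 3.
Definition hi (x y : R) : R :=
  sin y * (cosh x * sq x y - 2 * sinh x ^ 2) / sq x y ^ 3.

Lemma sq_pos (x y : R) : 0 <= cos y -> 0 < sq x y.
Proof. intros H. unfold sq. pose proof (cosh_ge_1 x). lra. Qed.

Ltac strip_derive x y :=
  let Hq := fresh "Hq" in let HS := fresh "HS" in let Hs := fresh "Hs" in
  pose proof (sinh_sqr x) as HS; pose proof (sin_sqr y) as Hs;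
  assert (Hq : sq x y <> 0) by (apply Rgt_not_eq, sq_pos; assumption);
  unfold sx, sy, jr, ji, hr, hi, sq in *;
  auto_derive;
  [ repeat split;
    try first [ exact Hq | apply (pow_nonzero _ 2); exact Hq | exact I ]
  | field_simplify_eq; [ring [HS Hs]|exact Hq] ].

Lemma sx_derive_x (x y : R) : 0 <= cos y ->
  is_derive (fun t => sx t y) x (jr x y).
Proof. intros H. strip_derive x y. Qed.

Lemma sx_derive_y (x y : R) : 0 <= cos y ->
  is_derive (fun t => sx x t) y (ji x y).
Proof. intros H. strip_derive x y. Qed.

Lemma sy_derive_x (x y : R) : 0 <= cos y ->
  is_derive (fun t => sy t y) x (- ji x y).
Proof. intros H. strip_derive x y. Qed.

Lemma sy_derive_y (x y : R) : 0 <= cos y ->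
  is_derive (fun t => sy x t) y (jr x y).
Proof. intros H. strip_derive x y. Qed.

Lemma jr_derive_x (x y : R) : 0 <= cos y ->
  is_derive (fun t => jr t y) x (hr x y).
Proof. intros H. strip_derive x y. Qed.

Lemma jr_derive_y (x y : R) : 0 <= cos y ->
  is_derive (fun t => jr x t) y (hi x y).
Proof. intros H. strip_derive x y. Qed.

Lemma ji_derive_x (x y : R) : 0 <= cos y ->
  is_derive (fun t => ji t y) x (hi x y).
Proof. intros H. strip_derive x y. Qed.

Lemma ji_derive_y (x y : R) : 0 <= cos y ->
  is_derive (fun t => ji x t) y (- hr x y).
Proof. intros H. strip_derive x y. Qed.

(** [dz/dw = 1 / (2 cosh (w / 2) ^ 2)] and [2 |cosh (w / 2)| ^ 2 = sq x y]. *)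
Lemma jacobian_sqr (x y : R) : 0 <= cos y ->
  jr x y * jr x y + ji x y * ji x y = / (sq x y * sq x y).
Proof.
  intros H. pose proof (sq_pos x y H) as Hq.
  pose proof (sinh_sqr x) as HS. pose proof (sin_sqr y) as Hs.
  unfold jr, ji, sq in *. field_simplify_eq; [ring [HS Hs]|lra].
Qed.

(** The defect [1 - |z| ^ 2] has the sign of [cos y]. Hence the lemmas on the strip map assume
    [0 <= cos y] instead of bounds on [y]. *)
Lemma strip_to_disk_norm (x y : R) : 0 <= cos y ->
  sx x y ^ 2 + sy x y ^ 2 = 1 - 2 * cos y / sq x y.
Proof.
  intros H. pose proof (sq_pos x y H) as Hq.
  pose proof (sinh_sqr x) as HS. pose proof (sin_sqr y) as Hs.
  unfold sx, sy, sq in *. field_simplify_eq; [ring [HS Hs]|lra].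
Qed.

Lemma strip_to_closed_disk (x y : R) : 0 <= cos y ->
  closed_disk (sx x y) (sy x y).
Proof.
  intros H. pose proof (sq_pos x y H) as Hq. unfold closed_disk.
  rewrite strip_to_disk_norm by exact H.
  assert (0 <= 2 * cos y / sq x y); [|lra].
  apply Rmult_le_pos; [lra|]. now left; apply Rinv_0_lt_compat.
Qed.

Lemma strip_to_disk (x y : R) : 0 < cos y -> disk (sx x y) (sy x y).
Proof.
  intros H. pose proof (sq_pos x y (Rlt_le _ _ H)) as Hq. unfold disk.
  rewrite strip_to_disk_norm by lra.
  assert (0 < 2 * cos y / sq x y) by (apply Rdiv_lt_0_compat; lra). lra.
Qed.

(** At a corner [|z| = 1] would force [cos y = 0] and the vanishing ordinate would force
    [sin y = 0]. *)
Lemma strip_avoids_corners (x y : R) : 0 <= cos y ->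
  (sx x y, sy x y) <> (1, 0) /\ (sx x y, sy x y) <> (-1, 0).
Proof.
  intros H. pose proof (sq_pos x y H) as Hq.
  assert (K : sx x y ^ 2 <> 1 \/ sy x y <> 0).
  { destruct (Req_dec (sy x y) 0) as [E|E]; [left|now right].
    intros E2. pose proof (strip_to_disk_norm x y H) as N.
    rewrite E, E2 in N. unfold sy in E.
    assert (Es : sin y = 0).
    { replace (sin y) with (sin y / sq x y * sq x y) by (field; lra).
      rewrite E; ring. }
    assert (Ec : cos y = 0).
    { replace (cos y) with (2 * cos y / sq x y * (sq x y / 2))
        by (field; lra).
      replace (2 * cos y / sq x y) with 0 by lra. ring. }
    pose proof (sin_sqr y) as Hs. rewrite Es, Ec in Hs. lra. }
  split; intros [= E1 E2]; rewrite E1, E2 in K; destruct K as [K|K];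
    apply K; ring.
Qed.

(** * The conformal factor on the strip *)

Definition pull (r : R -> R -> R) (x y : R) : R := r (sx x y) (sy x y).

Lemma pull_derive_x (r : R -> R -> R) (x y : R) : 0 <= cos y ->
  smooth_at r (sx x y) (sy x y) ->
  is_derive (fun t => pull r t y) x
    (pull (partial I1 r) x y * jr x y + pull (partial I2 r) x y * - ji x y).
Proof.
  intros Hy Hr. apply (smooth_at_chain r (fun t => sx t y) (fun t => sy t y));
    [exact Hr|now apply sx_derive_x|now apply sy_derive_x].
Qed.

Lemma pull_derive_y (r : R -> R -> R) (x y : R) : 0 <= cos y ->
  smooth_at r (sx x y) (sy x y) ->
  is_derive (fun t => pull r x t) y
    (pull (partial I1 r) x y * ji x y + pull (partial I2 r) x y * jr x y).
Proof.
  intros Hy Hr. apply (smooth_at_chain r (fun t => sx x t) (fun t => sy x t));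
    [exact Hr|now apply sx_derive_y|now apply sy_derive_y].
Qed.

(** Both first derivatives of [lv] have this shape, so one quotient rule yields all the second
    derivatives. *)
Lemma is_derive_log_gradient (r0 r1 r2 p1 p2 s q : R -> R)
    (t r0' r1' r2' p1' p2' s' q' : R) :
  is_derive r0 t r0' -> is_derive r1 t r1' -> is_derive r2 t r2' ->
  is_derive p1 t p1' -> is_derive p2 t p2' ->
  is_derive s t s' -> is_derive q t q' -> r0 t <> 0 -> q t <> 0 ->
  is_derive (fun t => (r1 t * p1 t + r2 t * p2 t) / (2 * r0 t) + s t / q t) t
    ((r1' * p1 t + r1 t * p1' + (r2' * p2 t + r2 t * p2')) / (2 * r0 t)
     - (r1 t * p1 t + r2 t * p2 t) * r0' / (2 * r0 t ^ 2)
     + (s' * q t - s t * q') / q t ^ 2).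
Proof.
  intros D0 D1 D2 D3 D4 D5 D6 H0 Hq. auto_derive.
  - repeat split; try (eexists; eassumption); lra.
  - assert (eta : forall (f : R -> R) l, is_derive f t l ->
      Derive (fun x : R => f x) t = l) by (intros; now apply is_derive_unique).
    rewrite (eta r0 _ D0), (eta r1 _ D1), (eta r2 _ D2), (eta p1 _ D3),
      (eta p2 _ D4), (eta s _ D5), (eta q _ D6). field. lra.
Qed.

(* [exp (2 lv) |dw|^2] is the pullback of [r |dz|^2] to the strip. *)
Definition lv (r : R -> R -> R) (x y : R) : R :=
  / 2 * ln (pull r x y) - ln (sq x y).

Definition lvx (r : R -> R -> R) (x y : R) : R :=
  (pull (partial I1 r) x y * jr x y + pull (partial I2 r) x y * - ji x y)
    / (2 * pull r x y) + - sinh x / sq x y.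

Definition lvy (r : R -> R -> R) (x y : R) : R :=
  (pull (partial I1 r) x y * ji x y + pull (partial I2 r) x y * jr x y)
    / (2 * pull r x y) + sin y / sq x y.

(** The second derivatives are kept exactly as [is_derive_log_gradient] produces them, which
    explains the double signs and the factor [0] below. *)
Definition lvxx (r : R -> R -> R) (x y : R) : R :=
  ((pull (partial I1 (partial I1 r)) x y * jr x y
    + pull (partial I2 (partial I1 r)) x y * - ji x y) * jr x y
   + pull (partial I1 r) x y * hr x y
   + ((pull (partial I1 (partial I2 r)) x y * jr x y
       + pull (partial I2 (partial I2 r)) x y * - ji x y) * - ji x y
      + pull (partial I2 r) x y * - hi x y)) / (2 * pull r x y)
  - (pull (partial I1 r) x y * jr x y + pull (partial I2 r) x y * - ji x y)
    * (pull (partial I1 r) x y * jr x y + pull (partial I2 r) x y * - ji x y)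
    / (2 * pull r x y ^ 2)
  + (- cosh x * sq x y - - sinh x * sinh x) / sq x y ^ 2.

Definition lvxy (r : R -> R -> R) (x y : R) : R :=
  ((pull (partial I1 (partial I1 r)) x y * ji x y
    + pull (partial I2 (partial I1 r)) x y * jr x y) * jr x y
   + pull (partial I1 r) x y * hi x y
   + ((pull (partial I1 (partial I2 r)) x y * ji x y
       + pull (partial I2 (partial I2 r)) x y * jr x y) * - ji x y
      + pull (partial I2 r) x y * - - hr x y)) / (2 * pull r x y)
  - (pull (partial I1 r) x y * jr x y + pull (partial I2 r) x y * - ji x y)
    * (pull (partial I1 r) x y * ji x y + pull (partial I2 r) x y * jr x y)
    / (2 * pull r x y ^ 2)
  + (0 * sq x y - - sinh x * - sin y) / sq x y ^ 2.

Definition lvyy (r : R -> R -> R) (x y : R) : R :=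
  ((pull (partial I1 (partial I1 r)) x y * ji x y
    + pull (partial I2 (partial I1 r)) x y * jr x y) * ji x y
   + pull (partial I1 r) x y * - hr x y
   + ((pull (partial I1 (partial I2 r)) x y * ji x y
       + pull (partial I2 (partial I2 r)) x y * jr x y) * jr x y
      + pull (partial I2 r) x y * hi x y)) / (2 * pull r x y)
  - (pull (partial I1 r) x y * ji x y + pull (partial I2 r) x y * jr x y)
    * (pull (partial I1 r) x y * ji x y + pull (partial I2 r) x y * jr x y)
    / (2 * pull r x y ^ 2)
  + (cos y * sq x y - sin y * - sin y) / sq x y ^ 2.

Lemma sq_derive_x (x y : R) : is_derive (fun t => sq t y) x (sinh x).
Proof. unfold sq. auto_derive; [exact I|ring]. Qed.

Lemma sq_derive_y (x y : R) : is_derive (fun t => sq x t) y (- sin y).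
Proof. unfold sq. auto_derive; [exact I|ring]. Qed.

Lemma cos_strip (y : R) : - (PI / 2) <= y <= PI / 2 -> 0 <= cos y.
Proof. intros Hy. apply cos_ge_0; lra. Qed.

Lemma strip_point (r : R -> R -> R) (x y : R) : 0 <= cos y ->
  regular_away_from_corners r ->
  smooth_at r (sx x y) (sy x y) /\ 0 < pull r x y.
Proof.
  intros Hy Hr. destruct (strip_avoids_corners x y Hy) as [N1 N2].
  destruct (Hr _ _ (strip_to_closed_disk x y Hy) N1 N2). now split.
Qed.

Lemma lv_derive_x (r : R -> R -> R) (x y : R) : 0 <= cos y ->
  regular_away_from_corners r -> is_derive (fun t => lv r t y) x (lvx r x y).
Proof.
  intros Hy Hr. destruct (strip_point r x y Hy Hr) as [Hs Hp].
  pose proof (pull_derive_x r x y Hy Hs) as D1.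
  pose proof (sq_derive_x x y) as D2. pose proof (sq_pos x y Hy) as Hq.
  unfold lv, lvx. auto_derive.
  - repeat split; try (eexists; eassumption); assumption.
  - apply is_derive_unique in D1, D2. cbn -[partial] in D1, D2. rewrite D1, D2.
    field. lra.
Qed.

Lemma lv_derive_y (r : R -> R -> R) (x y : R) : 0 <= cos y ->
  regular_away_from_corners r -> is_derive (fun t => lv r x t) y (lvy r x y).
Proof.
  intros Hy Hr. destruct (strip_point r x y Hy Hr) as [Hs Hp].
  pose proof (pull_derive_y r x y Hy Hs) as D1.
  pose proof (sq_derive_y x y) as D2. pose proof (sq_pos x y Hy) as Hq.
  unfold lv, lvy. auto_derive.
  - repeat split; try (eexists; eassumption); assumption.
  - apply is_derive_unique in D1, D2. cbn -[partial] in D1, D2. rewrite D1, D2.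
    field. lra.
Qed.

Lemma lvx_derive_x (r : R -> R -> R) (x y : R) : 0 <= cos y ->
  regular_away_from_corners r -> is_derive (fun t => lvx r t y) x (lvxx r x y).
Proof.
  intros Hy Hr. destruct (strip_point r x y Hy Hr) as [Hs Hp].
  pose proof (sq_pos x y Hy) as Hq.
  apply (is_derive_log_gradient (fun t => pull r t y)
    (fun t => pull (partial I1 r) t y) (fun t => pull (partial I2 r) t y)
    (fun t => jr t y) (fun t => - ji t y) (fun t => - sinh t)
    (fun t => sq t y)).
  - now apply pull_derive_x.
  - now apply pull_derive_x, smooth_at_partial.
  - now apply pull_derive_x, smooth_at_partial.
  - now apply jr_derive_x.
  - now apply (is_derive_opp (V := R_NormedModule)), ji_derive_x.
  - apply (is_derive_opp (V := R_NormedModule)), is_derive_sinh.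
  - apply sq_derive_x.
  - lra.
  - lra.
Qed.

Lemma lvx_derive_y (r : R -> R -> R) (x y : R) : 0 <= cos y ->
  regular_away_from_corners r -> is_derive (fun t => lvx r x t) y (lvxy r x y).
Proof.
  intros Hy Hr. destruct (strip_point r x y Hy Hr) as [Hs Hp].
  pose proof (sq_pos x y Hy) as Hq.
  apply (is_derive_log_gradient (fun t => pull r x t)
    (fun t => pull (partial I1 r) x t) (fun t => pull (partial I2 r) x t)
    (fun t => jr x t) (fun t => - ji x t) (fun t => - sinh x)
    (fun t => sq x t)).
  - now apply pull_derive_y.
  - now apply pull_derive_y, smooth_at_partial.
  - now apply pull_derive_y, smooth_at_partial.
  - now apply jr_derive_y.
  - now apply (is_derive_opp (V := R_NormedModule)), ji_derive_y.
  - apply (is_derive_const (V := R_NormedModule)).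
  - apply sq_derive_y.
  - lra.
  - lra.
Qed.

Lemma lvy_derive_y (r : R -> R -> R) (x y : R) : 0 <= cos y ->
  regular_away_from_corners r -> is_derive (fun t => lvy r x t) y (lvyy r x y).
Proof.
  intros Hy Hr. destruct (strip_point r x y Hy Hr) as [Hs Hp].
  pose proof (sq_pos x y Hy) as Hq.
  apply (is_derive_log_gradient (fun t => pull r x t)
    (fun t => pull (partial I1 r) x t) (fun t => pull (partial I2 r) x t)
    (fun t => ji x t) (fun t => jr x t) sin (fun t => sq x t)).
  - now apply pull_derive_y.
  - now apply pull_derive_y, smooth_at_partial.
  - now apply pull_derive_y, smooth_at_partial.
  - now apply ji_derive_y.
  - now apply jr_derive_y.
  - apply is_derive_sin.
  - apply sq_derive_y.
  - lra.
  - lra.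
Qed.

Lemma lvy_derive_x (r : R -> R -> R) (x y : R) : 0 <= cos y ->
  regular_away_from_corners r -> is_derive (fun t => lvy r t y) x (lvxy r x y).
Proof.
  intros Hy Hr. destruct (strip_point r x y Hy Hr) as [Hs Hp].
  pose proof (sq_pos x y Hy) as Hq.
  eassert (D : is_derive (fun t => lvy r t y) x _).
  { apply (is_derive_log_gradient (fun t => pull r t y)
      (fun t => pull (partial I1 r) t y) (fun t => pull (partial I2 r) t y)
      (fun t => ji t y) (fun t => jr t y) (fun _ => sin y) (fun t => sq t y)).
    - now apply pull_derive_x.
    - now apply pull_derive_x, smooth_at_partial.
    - now apply pull_derive_x, smooth_at_partial.
    - now apply ji_derive_x.
    - now apply jr_derive_x.
    - apply (is_derive_const (V := R_NormedModule)).
    - apply sq_derive_x.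
    - lra.
    - lra. }
  replace (lvxy r x y) with
    (((pull (partial I1 (partial I1 r)) x y * jr x y
       + pull (partial I2 (partial I1 r)) x y * - ji x y) * ji x y
      + pull (partial I1 r) x y * hi x y
      + ((pull (partial I1 (partial I2 r)) x y * jr x y
          + pull (partial I2 (partial I2 r)) x y * - ji x y) * jr x y
         + pull (partial I2 r) x y * hr x y)) / (2 * pull r x y)
     - (pull (partial I1 r) x y * ji x y + pull (partial I2 r) x y * jr x y)
       * (pull (partial I1 r) x y * jr x y + pull (partial I2 r) x y * - ji x y)
       / (2 * pull r x y ^ 2)
     + (0 * sq x y - sin y * sinh x) / sq x y ^ 2); [exact D|].
  (* Differentiating [lvy] in [x] produces the second partials of [r] in the other order; their
     symmetry identifies the result with [lvxy]. *)
  assert (E : pull (partial I1 (partial I2 r)) x y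
              = pull (partial I2 (partial I1 r)) x y)
    by now apply smooth_at_partial_comm.
  unfold lvxy. rewrite E. field. lra.
Qed.

Lemma exp_lv (r : R -> R -> R) (x y : R) : 0 <= cos y -> 0 < pull r x y ->
  exp (lv r x y) = sqrt (pull r x y) / sq x y.
Proof.
  intros Hy Hp. pose proof (sq_pos x y Hy) as Hq. unfold lv, Rdiv.
  rewrite <- (Rpower_sqrt _ Hp). unfold Rpower, Rminus.
  rewrite exp_plus, exp_Ropp, exp_ln by exact Hq. reflexivity.
Qed.

Lemma exp_2lv (r : R -> R -> R) (x y : R) : 0 <= cos y -> 0 < pull r x y ->
  exp (2 * lv r x y) = pull r x y / (sq x y * sq x y).
Proof.
  intros Hy Hp. pose proof (sq_pos x y Hy) as Hq.
  replace (2 * lv r x y) with (lv r x y + lv r x y) by ring.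
  rewrite exp_plus, exp_lv by assumption.
  rewrite <- (sqrt_sqrt (pull r x y)) at 3 by lra. field. lra.
Qed.

Lemma circle_angle (c s : R) : circle c s ->
  exists t, cos t = c /\ sin t = s.
Proof.
  unfold circle. intros H.
  assert (Hc : -1 <= c <= 1) by nra.
  destruct (Rle_dec 0 s) as [Hs|Hs].
  - exists (acos c). split; [now apply cos_acos|].
    rewrite sin_acos by exact Hc. unfold Rsqr.
    replace (1 - c * c) with (s * s) by lra. now apply sqrt_square.
  - exists (- acos c). rewrite cos_neg, sin_neg.
    split; [now apply cos_acos|].
    rewrite sin_acos by exact Hc. unfold Rsqr.
    replace (1 - c * c) with (- s * - s) by lra.
    rewrite sqrt_square by lra. ring.
Qed.

(** On a side, the [y]-derivative of the strip map is [e / sq x y] times the position vector, hence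
    radial; the flat curvature [1] of the circle accounts for the term [sin y / sq x y]. The sign
    [e] treats the upper and lower sides together. *)
Lemma lvy_boundary (r : R -> R -> R) (x y e k : R) :
  cos y = 0 -> sin y = e -> e * e = 1 -> regular_away_from_corners r ->
  (forall t, sin t * e > 0 -> circle (cos t) (sin t) ->
     geodesic_curvature (conformal r) unit_circle t = k) ->
  lvy r x y = e * k * exp (lv r x y).
Proof.
  intros Hc Hs He Hr Hk.
  destruct (strip_point r x y ltac:(lra) Hr) as [_ Hp].
  pose proof (sq_pos x y ltac:(lra)) as Hq.
  assert (HC : circle (sx x y) (sy x y)).
  { unfold circle. rewrite strip_to_disk_norm, Hc by lra. field. lra. }
  destruct (circle_angle _ _ HC) as [t [Ec Es]].
  specialize (Hk t).
  rewrite Ec, Es in Hk.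
  assert (Hse : sy x y * e > 0).
  { unfold sy. rewrite Hs.
    replace (e / sq x y * e) with (e * e / sq x y) by (field; lra).
    rewrite He. apply Rdiv_lt_0_compat; lra. }
  specialize (Hk Hse HC).
  rewrite geodesic_curvature_unit_circle in Hk by (rewrite Ec, Es; exact Hp).
  rewrite Ec, Es in Hk.
  rewrite <- Hk, exp_lv by (assumption || lra).
  change (r (sx x y) (sy x y)) with (pull r x y).
  change (partial I1 r (sx x y) (sy x y)) with (pull (partial I1 r) x y).
  change (partial I2 r (sx x y) (sy x y)) with (pull (partial I2 r) x y).
  assert (Hsq : 0 < sqrt (pull r x y)) by now apply sqrt_lt_R0.
  unfold lvy, ji, jr, sx, sy. rewrite Hc, Hs.
  field_simplify_eq; [ring [He]|lra].
Qed.

Ltac contstrip :=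
  repeat first
    [ assumption
    | apply continuity_2d_pt_const
    | apply continuity_2d_pt_id1
    | apply continuity_2d_pt_id2
    | apply (continuity_2d_pt_derivable1 sinh cosh), is_derive_sinh
    | apply (continuity_2d_pt_derivable1 cosh sinh), is_derive_cosh
    | apply (continuity_2d_pt_derivable2 sin cos), is_derive_sin
    | apply (continuity_2d_pt_derivable2 cos (fun t => - sin t)), is_derive_cos
    | apply continuity_2d_pt_opp
    | apply continuity_2d_pt_plus
    | apply continuity_2d_pt_minus
    | apply continuity_2d_pt_mult
    | apply continuity_2d_pt_inv ].

Lemma strip_map_continuity (x y : R) : 0 <= cos y ->
  continuity_2d_pt sq x y /\ continuity_2d_pt sx x y /\
  continuity_2d_pt sy x y /\ continuity_2d_pt jr x y /\
  continuity_2d_pt ji x y /\ continuity_2d_pt hr x y /\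
  continuity_2d_pt hi x y.
Proof.
  intros Hy. pose proof (sq_pos x y Hy) as Hq.
  assert (Hq1 : sq x y <> 0) by lra.
  assert (C : continuity_2d_pt sq x y) by (unfold sq; contstrip).
  repeat split; try exact C; unfold sx, sy, jr, ji, hr, hi, Rdiv; simpl;
    contstrip; repeat apply Rmult_integral_contrapositive_currified; lra.
Qed.

Lemma pull_continuity (r : R -> R -> R) (x y : R) : 0 <= cos y ->
  smooth_at r (sx x y) (sy x y) -> continuity_2d_pt (pull r) x y.
Proof.
  intros Hy Hr. destruct (strip_map_continuity x y Hy) as (_ & C1 & C2 & _).
  apply (continuity_2d_pt_comp_2d r sx sy); [now apply smooth_at_continuity| |];
    assumption.
Qed.

Lemma lv_continuity (r : R -> R -> R) (x y : R) : 0 <= cos y ->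
  regular_away_from_corners r ->
  continuity_2d_pt (lv r) x y /\ continuity_2d_pt (lvx r) x y /\
  continuity_2d_pt (lvy r) x y /\ continuity_2d_pt (lvxx r) x y /\
  continuity_2d_pt (lvxy r) x y /\ continuity_2d_pt (lvyy r) x y.
Proof.
  intros Hy Hr. destruct (strip_point r x y Hy Hr) as [Hs Hp].
  pose proof (sq_pos x y Hy) as Hq.
  assert (Hq1 : sq x y <> 0) by lra. assert (Hp1 : pull r x y <> 0) by lra.
  destruct (strip_map_continuity x y Hy) as (C0 & C1 & C2 & C3 & C4 & C5 & C6).
  pose proof (pull_continuity r x y Hy Hs) as D.
  assert (D1 : forall i, continuity_2d_pt (pull (partial i r)) x y).
  { intros i. now apply pull_continuity, smooth_at_partial. }
  assert (D2 : forall i j,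
    continuity_2d_pt (pull (partial i (partial j r))) x y).
  { intros i j. now apply pull_continuity, smooth_at_partial,
      smooth_at_partial. }
  pose proof (D1 I1). pose proof (D1 I2).
  pose proof (D2 I1 I1). pose proof (D2 I1 I2).
  pose proof (D2 I2 I1). pose proof (D2 I2 I2).
  pose proof (continuity_2d_pt_ln _ _ _ D Hp).
  pose proof (continuity_2d_pt_ln _ _ _ C0 Hq).
  repeat split; unfold lv, lvx, lvy, lvxx, lvxy, lvyy, Rdiv; simpl;
    contstrip; repeat apply Rmult_integral_contrapositive_currified; lra.
Qed.

Lemma disk_to_strip (r : R -> R -> R) (K kp km : R) :
  regular_away_from_corners r ->
  (forall x y : R, disk x y -> gauss_curvature (conformal r) x y = K) ->
  (forall t : R, Gamma_plus (cos t) (sin t) ->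
     geodesic_curvature (conformal r) unit_circle t = kp) ->
  (forall t : R, Gamma_minus (cos t) (sin t) ->
     geodesic_curvature (conformal r) unit_circle t = km) ->
  liouville_strip (- (PI / 2)) (PI / 2) K kp km
    (lv r) (lvx r) (lvy r) (lvxx r) (lvxy r) (lvyy r).
Proof.
  intros Hr HK Hkp Hkm.
  constructor; try (intros x y Hy; apply cos_strip in Hy).
  - now apply lv_derive_x.
  - now apply lv_derive_y.
  - now apply lvx_derive_x.
  - now apply lvx_derive_y.
  - now apply lvy_derive_x.
  - now apply lvy_derive_y.
  - now apply lv_continuity.
  - now apply lv_continuity.
  - now apply lv_continuity.
  - now apply lv_continuity.
  - now apply lv_continuity.
  - now apply lv_continuity.
  - intros x y Hy.
    assert (Hc : 0 < cos y) by (apply cos_gt_0; lra).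
    assert (Hc' : 0 <= cos y) by lra.
    destruct (strip_point r x y Hc' Hr) as [Hs Hp].
    pose proof (HK _ _ (strip_to_disk x y Hc)) as E.
    rewrite gauss_curvature_conformal in E by assumption.
    pose proof (sq_pos x y Hc') as Hq.
    pose proof (jacobian_sqr x y Hc') as HJ.
    pose proof (sinh_sqr x) as HS. pose proof (sin_sqr y) as Hsn.
    rewrite exp_2lv by assumption.
    replace (pull r x y / (sq x y * sq x y))
      with (pull r x y * / (sq x y * sq x y)) by (field; lra).
    rewrite <- HJ, <- E.
    (* [- ln (sq x y)] is the logarithm of the modulus of the holomorphic function [dz/dw], hence
       harmonic, and drops out of the curvature equation. *)
    assert (HZ : (- cosh x * sq x y - - sinh x * sinh x) / sq x y ^ 2
      + (cos y * sq x y - sin y * - sin y) / sq x y ^ 2 = 0).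
    { unfold sq in *. field_simplify_eq; [ring [HS Hsn]|lra]. }
    assert (EC : pull (partial I1 (partial I2 r)) x y
              = pull (partial I2 (partial I1 r)) x y)
      by now apply smooth_at_partial_comm.
    unfold lvxx, lvyy. rewrite EC.
    change (r (sx x y) (sy x y)) with (pull r x y).
    change (partial I1 r (sx x y) (sy x y)) with (pull (partial I1 r) x y).
    change (partial I2 r (sx x y) (sy x y)) with (pull (partial I2 r) x y).
    change (partial I1 (partial I1 r) (sx x y) (sy x y))
      with (pull (partial I1 (partial I1 r)) x y).
    change (partial I2 (partial I2 r) (sx x y) (sy x y))
      with (pull (partial I2 (partial I2 r)) x y).
    match goal with |- ?A - ?B + ?C + (?A' - ?B' + ?C') = ?D =>
      enough (A - B + (A' - B') = D) by lra end.
    field. lra.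
  - intros x. rewrite (lvy_boundary r x (PI / 2) 1 kp).
    + ring.
    + apply cos_PI2.
    + apply sin_PI2.
    + ring.
    + exact Hr.
    + intros t Ht Hc. apply Hkp. split; [exact Hc|lra].
  - intros x. rewrite (lvy_boundary r x (- (PI / 2)) (-1) km).
    + ring.
    + rewrite cos_neg. apply cos_PI2.
    + rewrite sin_neg, sin_PI2. reflexivity.
    + ring.
    + exact Hr.
    + intros t Ht Hc. apply Hkm. split; [exact Hc|lra].
Qed.

(** * Asymptotics at the corners *)

Lemma exp_neg_eventually (delta : R) : 0 < delta ->
  exists M, 0 <= M /\ forall x, M <= x -> exp (- x) < delta.
Proof.
  intros Hd. exists (Rabs (ln delta) + 1).
  split; [pose proof (Rabs_pos (ln delta)); lra|].
  intros x Hx. rewrite <- (exp_ln delta Hd) at 1. apply exp_increasing.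
  pose proof (Rabs_maj2 (ln delta)). lra.
Qed.

(** From [1 - tanh (w / 2) = exp (- w / 2) / cosh (w / 2)]. *)
Lemma strip_dist_corner (x y : R) : 0 <= cos y ->
  (sx x y - 1) ^ 2 + sy x y ^ 2 = 2 * exp (- x) / sq x y.
Proof.
  intros Hy. pose proof (sq_pos x y Hy) as Hq.
  pose proof (sinh_sqr x) as HS. pose proof (sin_sqr y) as Hs.
  assert (E : exp (- x) = cosh x - sinh x) by (unfold cosh, sinh; field).
  rewrite E. unfold sx, sy, sq in *. field_simplify_eq; [ring [HS Hs]|lra].
Qed.

(** [sq x y] is [exp x / 2] times [1 + w] with [0 <= w <= 3 exp (- x)]; the lower bound on [w] uses
    [0 <= cos y], and [ln (1 + w) <= w]. *)
Lemma ln_sq_asymptotics (x y : R) : 0 <= x -> 0 <= cos y ->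
  x - ln 2 <= ln (sq x y) <= x - ln 2 + 3 * exp (- x).
Proof.
  intros Hx Hy. pose proof (exp_pos x) as Hex. pose proof (exp_pos (- x)) as He.
  assert (H1 : exp x * exp (- x) = 1).
  { rewrite <- exp_plus, Rplus_opp_r. apply exp_0. }
  assert (Hle : exp (- x) <= 1).
  { rewrite <- exp_0. destruct (Req_dec x 0) as [->|h].
    - rewrite Ropp_0. lra.
    - left. apply exp_increasing. lra. }
  pose proof (COS_bound y) as [_ Hc].
  set (w := 2 * exp (- x) * cos y + exp (- x) * exp (- x)).
  assert (Hw : 0 <= w <= 3 * exp (- x)) by (unfold w; nra).
  assert (E : sq x y = exp x * (/ 2 * (1 + w))).
  { unfold sq, cosh, w.
    replace (exp x * (/ 2 * (1 + (2 * exp (- x) * cos y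
      + exp (- x) * exp (- x))))) with
      (/ 2 * (exp x + 2 * (exp x * exp (- x)) * cos y
        + (exp x * exp (- x)) * exp (- x))) by ring.
    rewrite H1. field. }
  rewrite E, ln_mult, ln_exp, ln_mult, ln_Rinv by lra.
  assert (H2 : 0 <= ln (1 + w)).
  { rewrite <- ln_1. apply ln_le; lra. }
  assert (H3 : ln (1 + w) <= w).
  { rewrite <- (ln_exp w) at 2. apply ln_le; [lra|]. apply exp_ineq1_le. }
  lra.
Qed.

(** Changing the sign of [x] reflects the disk and exchanges the corners, so the corner [(s, 0)] can
    always be approached along [s * x] with [x] large. *)
Lemma strip_map_sign (s x y : R) : s * s = 1 ->
  sx (s * x) y = s * sx x y /\ sy (s * x) y = sy x y /\ sq (s * x) y = sq x y.
Proof.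
  intros Hs.
  assert (H : s = 1 \/ s = -1).
  { destruct (Rmult_integral (s - 1) (s + 1)) as [h|h]; [lra|left; lra|].
    right; lra. }
  unfold sx, sy, sq, sinh, cosh. destruct H as [-> | ->].
  - rewrite !Rmult_1_l. now repeat split.
  - replace (- (-1 * x)) with x by ring. replace (-1 * x) with (- x) by ring.
    rewrite (Rplus_comm (exp (- x)) (exp x)).
    repeat split. unfold Rdiv. ring.
Qed.

Lemma has_corner_limit (u : R -> R -> R) (a b : R) :
  filterlim (fun q : R * R => u (fst q) (snd q))
    (within (fun q : R * R => closed_disk (fst q) (snd q)) (locally (a, b)))
    (locally (u a b)) ->
  forall eps, 0 < eps -> locally_2d (fun x y =>
    closed_disk x y -> Rabs (u x y - u a b) < eps) a b.
Proof.
  intros H eps Heps. apply locally_2d_locally.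
  exact (proj1 (filterlim_locally (U := R_UniformSpace) _ _) H
    (mkposreal eps Heps)).
Qed.

(** Both [|z - p|] and [|dz/dw|] are asymptotic to [2 exp (- x)], so [lv] is close to
    [u + (alpha + 1) (ln 2 - x)]; the continuity of [u] at the corner supplies the limit [c]. *)
Lemma corner_asymptotics (r : R -> R -> R) (s alpha : R) : s * s = 1 ->
  has_corner r s 0 alpha ->
  exists c, forall eps, 0 < eps -> exists M, forall x y, M <= x ->
    - (PI / 2) <= y <= PI / 2 ->
    Rabs (lv r (s * x) y + (alpha + 1) * x - c) <= eps.
Proof.
  intros Hs [u [Hl Hu]].
  exists (u s 0 + (alpha + 1) * ln 2). intros eps Heps.
  pose proof (locally_2d_and _ _ _ _ Hl
    (has_corner_limit u s 0 Hu (eps / 2) ltac:(lra))) as [d Hd].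
  clear Hl Hu.
  (* Coefficient of [ln (sq x y)] in [lv]: [alpha / 2] from the distance to the corner and [1] from
     the Jacobian. *)
  pose (A := Rabs (alpha / 2 + 1)).
  assert (HA : 0 <= A) by apply Rabs_pos.
  (* The first bound keeps the image within [2 exp (- x) < d] of the corner; the second makes the
     error [3 A exp (- x)] at most [eps / 2]. *)
  destruct (exp_neg_eventually (Rmin (d / 2) (eps / (6 * (A + 1)))))
    as [M [HM0 HM]].
  { pose proof (cond_pos d). apply Rmin_glb_lt; [lra|].
    apply Rdiv_lt_0_compat; lra. }
  exists M. intros x y Hx Hy. apply cos_strip in Hy.
  specialize (HM x Hx).
  assert (HM1 : exp (- x) < d / 2)
    by (eapply Rlt_le_trans; [exact HM|apply Rmin_l]).
  assert (HM2 : exp (- x) < eps / (6 * (A + 1)))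
    by (eapply Rlt_le_trans; [exact HM|apply Rmin_r]).
  clear HM.
  pose proof (exp_pos (- x)) as He. pose proof (exp_pos x) as He'.
  pose proof (sq_pos x y Hy) as Hq.
  pose proof (strip_dist_corner x y Hy) as HD.
  assert (Hq2 : exp x / 2 <= sq x y) by (unfold sq, cosh; lra).
  assert (HD2 : 2 * exp (- x) / sq x y <= (2 * exp (- x)) ^ 2).
  { replace (2 * exp (- x) / sq x y) with (2 * exp (- x) * / sq x y)
      by reflexivity.
    replace ((2 * exp (- x)) ^ 2) with (2 * exp (- x) * (2 * exp (- x)))
      by ring.
    apply Rmult_le_compat_l; [lra|].
    replace (2 * exp (- x)) with (/ (exp x / 2))
      by (rewrite exp_Ropp; field; lra).
    apply Rinv_le_contravar; lra. }
  destruct (strip_map_sign s x y Hs) as (Ex & Ey & Eq).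
  assert (Hy' : 0 <= cos y) by exact Hy.
  pose proof (strip_to_closed_disk (s * x) y Hy') as HC.
  pose proof (strip_avoids_corners (s * x) y Hy') as [N1 N2].
  assert (Hn : (sx (s * x) y, sy (s * x) y) <> (s, 0)).
  { assert (h : s = 1 \/ s = -1).
    { destruct (Rmult_integral (s - 1) (s + 1)) as [h|h]; lra. }
    destruct h as [-> | ->]; assumption. }
  assert (B1 : Rabs (sx (s * x) y - s) < d).
  { rewrite Ex. apply Rabs_lt_between'.
    assert ((s * sx x y - s) ^ 2 = (sx x y - 1) ^ 2).
    { transitivity (s * s * (sx x y - 1) ^ 2); [ring|rewrite Hs; ring]. }
    pose proof (pow2_ge_0 (sy x y)). pose proof (cond_pos d).
    assert ((s * sx x y - s) ^ 2 < d ^ 2) by nra.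
    nra. }
  assert (B2 : Rabs (sy (s * x) y - 0) < d).
  { rewrite Ey. apply Rabs_lt_between'.
    pose proof (pow2_ge_0 (sx x y - 1)). pose proof (cond_pos d).
    assert (sy x y ^ 2 < d ^ 2) by nra.
    nra. }
  destruct (Hd _ _ B1 B2) as [H1 H2]. clear Hd.
  destruct (H1 HC Hn) as [_ Er]. specialize (H2 HC). clear H1.
  assert (Ed : ln (dist_euc (sx (s * x) y) (sy (s * x) y) s 0)
    = / 2 * (ln 2 - x - ln (sq x y))).
  { unfold dist_euc, Rsqr.
    replace ((sx (s * x) y - s) * (sx (s * x) y - s)
      + (sy (s * x) y - 0) * (sy (s * x) y - 0))
      with (2 * exp (- x) / sq x y).
    2:{ rewrite <- HD, Ex, Ey.
        transitivity (s * s * (sx x y - 1) ^ 2 + sy x y ^ 2);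
          [rewrite Hs|]; ring. }
    assert (0 < 2 * exp (- x) / sq x y) by (apply Rdiv_lt_0_compat; lra).
    rewrite <- Rpower_sqrt by assumption. unfold Rpower.
    rewrite ln_exp. unfold Rdiv.
    rewrite ln_mult, ln_mult, ln_exp, ln_Rinv; try lra.
    now apply Rinv_0_lt_compat. }
  unfold lv, pull. rewrite Er, Eq.
  unfold Rpower. rewrite Ed, <- exp_plus, ln_exp.
  pose proof (ln_sq_asymptotics x y ltac:(lra) Hy) as Hln.
  set (w := ln (sq x y) - (x - ln 2)).
  set (U := u (sx (s * x) y) (sy (s * x) y)) in *.
  replace (/ 2 * (2 * U + 2 * alpha * (/ 2 * (ln 2 - x - ln (sq x y))))
    - ln (sq x y) + (alpha + 1) * x - (u s 0 + (alpha + 1) * ln 2))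
    with ((U - u s 0) + - ((alpha / 2 + 1) * w)) by (unfold w; field).
  eapply Rle_trans; [apply Rabs_triang|].
  rewrite Rabs_Ropp, Rabs_mult, (Rabs_right w) by (unfold w; lra).
  fold A.
  assert (Hw : A * w <= A * (3 * exp (- x))).
  { apply Rmult_le_compat_l; [exact HA|unfold w; lra]. }
  assert (He6 : 6 * (A + 1) * exp (- x) <= 6 * (A + 1) * (eps / (6 * (A + 1))))
    by (apply Rmult_le_compat_l; lra).
  replace (6 * (A + 1) * (eps / (6 * (A + 1)))) with eps in He6
    by (field; lra).
  lra.
Qed.

Lemma corner_orders_eq (r : R -> R -> R) (alpha1 alpha2 K kp km : R) :
  alpha1 > -1 -> alpha2 > -1 -> regular_away_from_corners r ->
  (forall x y : R, disk x y -> gauss_curvature (conformal r) x y = K) ->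
  (forall t : R, Gamma_plus (cos t) (sin t) ->
     geodesic_curvature (conformal r) unit_circle t = kp) ->
  (forall t : R, Gamma_minus (cos t) (sin t) ->
     geodesic_curvature (conformal r) unit_circle t = km) ->
  has_corner r 1 0 alpha1 -> has_corner r (-1) 0 alpha2 ->
  alpha1 = alpha2.
Proof.
  intros H1 H2 Hr HK Hkp Hkm Hc1 Hc2.
  destruct (corner_asymptotics r 1 alpha1 ltac:(ring) Hc1) as [c1 A1].
  destruct (corner_asymptotics r (-1) alpha2 ltac:(ring) Hc2) as [c2 A2].
  pose proof PI_RGT_0.
  enough (alpha1 + 1 = alpha2 + 1) by lra.
  apply (liouville_strip_exponents (- (PI / 2)) (PI / 2) K kp km
    (alpha1 + 1) (alpha2 + 1) c1 c2 _ _ _ _ _ _ ltac:(lra) ltac:(lra)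
    ltac:(lra) (disk_to_strip r K kp km Hr HK Hkp Hkm)).
  - intros eps Heps. destruct (A1 eps Heps) as [M HM]. exists M.
    intros x y Hx Hy. rewrite <- (Rmult_1_l x) at 1. now apply HM.
  - intros eps Heps. destruct (A2 eps Heps) as [M HM]. exists M.
    intros x y Hx Hy. replace (- x) with (-1 * x) by ring. now apply HM.
Qed.

(** * The spherical bigon *)

(* Functions built from the coordinates by these operations are smooth, because
   the class is closed under partial derivatives. *)
Inductive expr : Set :=
  | EX : expr
  | EY : expr
  | ECst : R -> expr
  | EAdd : expr -> expr -> expr
  | EMul : expr -> expr -> expr
  | EExp : expr -> expr
  | ELn : expr -> expr
  | EInv : expr -> expr.

Fixpoint eval (e : expr) (x y : R) : R :=
  match e with
  | EX => x
  | EY => y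
  | ECst c => c
  | EAdd e1 e2 => eval e1 x y + eval e2 x y
  | EMul e1 e2 => eval e1 x y * eval e2 x y
  | EExp e1 => exp (eval e1 x y)
  | ELn e1 => ln (eval e1 x y)
  | EInv e1 => / eval e1 x y
  end.

(** Positivity is required under [EInv] as under [ELn]: the denominators at hand are positive, and
    [continuity_2d_pt_pos] then shows in both cases that the domain is open. *)
Fixpoint defined (e : expr) (x y : R) : Prop :=
  match e with
  | EX | EY | ECst _ => True
  | EAdd e1 e2 | EMul e1 e2 => defined e1 x y /\ defined e2 x y
  | EExp e1 => defined e1 x y
  | ELn e1 | EInv e1 => defined e1 x y /\ 0 < eval e1 x y
  end.

Fixpoint diff (i : index) (e : expr) : expr :=
  match e with
  | EX => ECst (match i with I1 => 1 | I2 => 0 end)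
  | EY => ECst (match i with I1 => 0 | I2 => 1 end)
  | ECst _ => ECst 0
  | EAdd e1 e2 => EAdd (diff i e1) (diff i e2)
  | EMul e1 e2 => EAdd (EMul (diff i e1) e2) (EMul e1 (diff i e2))
  | EExp e1 => EMul (diff i e1) (EExp e1)
  | ELn e1 => EMul (diff i e1) (EInv e1)
  | EInv e1 => EMul (ECst (-1)) (EMul (diff i e1) (EMul (EInv e1) (EInv e1)))
  end.

Lemma defined_diff (i : index) (e : expr) (x y : R) :
  defined e x y -> defined (diff i e) x y.
Proof. induction e; simpl; tauto. Qed.

Lemma eval_continuity (e : expr) (x y : R) :
  defined e x y -> continuity_2d_pt (eval e) x y.
Proof.
  induction e; simpl; intros H.
  - apply continuity_2d_pt_id1.
  - apply continuity_2d_pt_id2.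
  - apply continuity_2d_pt_const.
  - now apply continuity_2d_pt_plus; [apply IHe1|apply IHe2].
  - now apply continuity_2d_pt_mult; [apply IHe1|apply IHe2].
  - now apply continuity_2d_pt_exp, IHe.
  - now apply continuity_2d_pt_ln; [apply IHe|].
  - apply continuity_2d_pt_inv; [now apply IHe|lra].
Qed.

Lemma continuity_2d_pt_pos (f : R -> R -> R) (x y : R) :
  continuity_2d_pt f x y -> 0 < f x y -> locally_2d (fun u v => 0 < f u v) x y.
Proof.
  intros Hf Hp. generalize (Hf (mkposreal _ Hp)).
  apply locally_2d_impl, locally_2d_forall. simpl. intros u v H.
  apply Rabs_lt_between in H. lra.
Qed.

Lemma defined_locally (e : expr) (x y : R) :
  defined e x y -> locally_2d (defined e) x y.
Proof.
  induction e; simpl; intros H;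
    try (apply locally_2d_forall; intros; exact I); try tauto.
  1, 2: apply locally_2d_and; tauto.
  all: apply locally_2d_and; [tauto|].
  all: apply continuity_2d_pt_pos; [now apply eval_continuity|tauto].
Qed.

Lemma eval_derive1 (e : expr) (x y : R) : defined e x y ->
  is_derive (fun t => eval e t y) x (eval (diff I1 e) x y).
Proof.
  induction e; simpl; intros H.
  - apply (is_derive_id (K := R_AbsRing)).
  - apply (is_derive_const (V := R_NormedModule)).
  - apply (is_derive_const (V := R_NormedModule)).
  - apply (is_derive_plus (V := R_NormedModule)); tauto.
  - apply (is_derive_mult (fun t : R => eval e1 t y) (fun t => eval e2 t y));
      try tauto.
    intros; apply Rmult_comm.
  - apply (is_derive_comp (V := R_NormedModule) exp (fun t => eval e t y));
      [apply is_derive_exp|tauto].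
  - apply (is_derive_comp (V := R_NormedModule) ln (fun t => eval e t y));
      [|tauto].
    now apply is_derive_ln.
  - replace (-1 * (eval (diff I1 e) x y * (/ eval e x y * / eval e x y)))
      with (- eval (diff I1 e) x y / eval e x y ^ 2) by (field; lra).
    apply (is_derive_inv (fun t => eval e t y)); [tauto|lra].
Qed.

Lemma eval_derive2 (e : expr) (x y : R) : defined e x y ->
  is_derive (fun t => eval e x t) y (eval (diff I2 e) x y).
Proof.
  induction e; simpl; intros H.
  - apply (is_derive_const (V := R_NormedModule)).
  - apply (is_derive_id (K := R_AbsRing)).
  - apply (is_derive_const (V := R_NormedModule)).
  - apply (is_derive_plus (V := R_NormedModule)); tauto.
  - apply (is_derive_mult (fun t : R => eval e1 x t) (fun t => eval e2 x t));
      try tauto.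
    intros; apply Rmult_comm.
  - apply (is_derive_comp (V := R_NormedModule) exp (fun t => eval e x t));
      [apply is_derive_exp|tauto].
  - apply (is_derive_comp (V := R_NormedModule) ln (fun t => eval e x t));
      [|tauto].
    now apply is_derive_ln.
  - replace (-1 * (eval (diff I2 e) x y * (/ eval e x y * / eval e x y)))
      with (- eval (diff I2 e) x y / eval e x y ^ 2) by (field; lra).
    apply (is_derive_inv (fun t => eval e x t)); [tauto|lra].
Qed.

Lemma partial_eval (i : index) (e : expr) (x y : R) : defined e x y ->
  partial i (eval e) x y = eval (diff i e) x y.
Proof.
  intros H. destruct i; apply is_derive_unique.
  - now apply eval_derive1.
  - now apply eval_derive2.
Qed.

(** Induction on the order, for all expressions at once: near the point the partials of [eval e]
    coincide with the evaluations of [diff i e]. *)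
Lemma eval_smooth_at (e : expr) (x y : R) :
  defined e x y -> smooth_at (eval e) x y.
Proof.
  intros H. apply defined_locally in H. revert H.
  apply locally_2d_impl, locally_2d_forall. intros u v H n. revert e u v H.
  clear x y. induction n as [|n IH]; intros e x y H; simpl.
  - split; [now apply eval_continuity|exact I].
  - split; [now apply eval_continuity|].
    split; [eexists; now apply eval_derive1|].
    split; [eexists; now apply eval_derive2|].
    split.
    + apply (ex_diff_n_ext_loc (eval (diff I1 e)));
        [|now apply IH, defined_diff].
      apply defined_locally in H. revert H.
      apply locally_2d_impl, locally_2d_forall. intros u v H.
      symmetry. now apply (partial_eval I1).
    + apply (ex_diff_n_ext_loc (eval (diff I2 e)));
        [|now apply IH, defined_diff].
      apply defined_locally in H. revert H.
      apply locally_2d_impl, locally_2d_forall. intros u v H.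
      symmetry. now apply (partial_eval I2).
Qed.

Lemma partial_partial_eval (i j : index) (e : expr) (x y : R) :
  defined e x y ->
  partial i (partial j (eval e)) x y = eval (diff i (diff j e)) x y.
Proof.
  intros H. rewrite <- partial_eval by now apply defined_diff.
  apply defined_locally in H.
  destruct i; apply Derive_ext_loc.
  - apply locally_2d_1d_const_y in H. revert H. apply filter_imp.
    intros t Ht. now apply partial_eval.
  - apply locally_2d_1d_const_x in H. revert H. apply filter_imp.
    intros t Ht. now apply partial_eval.
Qed.

(** * The bigon metric and its curvatures *)

(** [|s + z| ^ 2], which vanishes at [(- s, 0)]: the squared distance to [(s, 0)] is
    [dist2 (- s)]. *)
Definition dist2 (s x y : R) : R := (s + x) * (s + x) + y * y.

Definition edist2 (s : R) : expr :=
  EAdd (EMul (EAdd (ECst s) EX) (EAdd (ECst s) EX)) (EMul EY EY).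

Definition epower (beta : R) (e : expr) : expr :=
  EExp (EMul (ECst beta) (ELn e)).

(* [P Q / (A B (P + Q)^2)] with [A = |s + z|^2], [B = |s - z|^2], [P = A^beta],
   [Q = B^beta]: for [s = 1] or [-1], a spherical bigon of angle [PI beta] up to
   a constant factor. *)
Definition ebigon (s beta : R) : expr :=
  let A := edist2 s in
  let B := edist2 (- s) in
  let P := epower beta A in
  let Q := epower beta B in
  EMul (EMul P Q) (EInv (EMul (EMul A B) (EMul (EAdd P Q) (EAdd P Q)))).

Lemma dist2_pos (s x y : R) : (x, y) <> (- s, 0) -> 0 < dist2 s x y.
Proof.
  intros H. unfold dist2.
  pose proof (Rle_0_sqr (s + x)) as H1. pose proof (Rle_0_sqr y) as H2.
  unfold Rsqr in *.
  destruct (Req_dec y 0) as [Hy|Hy].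
  - assert (Hx : s + x <> 0) by (intros h; apply H; f_equal; lra).
    pose proof (Rsqr_pos_lt _ Hx). unfold Rsqr in *. lra.
  - pose proof (Rsqr_pos_lt _ Hy). unfold Rsqr in *. lra.
Qed.

Lemma ebigon_defined (s beta x y : R) :
  (x, y) <> (- s, 0) -> (x, y) <> (s, 0) ->
  defined (ebigon s beta) x y.
Proof.
  intros H1 H2. apply dist2_pos in H1.
  rewrite <- (Ropp_involutive s) in H2 at 1. apply dist2_pos in H2.
  unfold dist2 in *. simpl.
  set (A := (s + x) * (s + x) + y * y) in *.
  set (B := (- s + x) * (- s + x) + y * y) in *.
  pose proof (exp_pos (beta * ln A)). pose proof (exp_pos (beta * ln B)).
  repeat split; try assumption.
  repeat apply Rmult_lt_0_compat; lra.
Qed.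

Lemma ebigon_pos (s beta x y : R) :
  (x, y) <> (- s, 0) -> (x, y) <> (s, 0) -> 0 < eval (ebigon s beta) x y.
Proof.
  intros H1 H2. destruct (ebigon_defined s beta x y H1 H2) as [_ [_ H]].
  simpl. apply Rmult_lt_0_compat.
  - apply Rmult_lt_0_compat; apply exp_pos.
  - now apply Rinv_0_lt_compat.
Qed.

(** For [f = ((1 + z) / (1 - z)) ^ beta], the unit-sphere metric [4 |f'| ^ 2 / (1 + |f| ^ 2) ^ 2] is
    [16 beta ^ 2] times this factor, whence the constant. *)
Lemma ebigon_gauss_curvature (beta x y : R) :
  (x, y) <> (-1, 0) -> (x, y) <> (1, 0) ->
  gauss_curvature (conformal (eval (ebigon 1 beta))) x y = 16 * beta ^ 2.
Proof.
  intros H1 H2.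
  pose proof (ebigon_defined 1 beta x y H1 H2) as Hd.
  rewrite gauss_curvature_conformal;
    [|now apply eval_smooth_at|now apply ebigon_pos].
  rewrite !partial_partial_eval, !partial_eval by exact Hd.
  apply (dist2_pos 1) in H1.
  rewrite <- (Ropp_involutive 1) in H2 at 1. apply dist2_pos in H2.
  unfold dist2 in *.
  cbn [ebigon epower edist2 eval diff].
  (* Once differentiated, the claim is a rational identity in [x], [y], [beta] and the two powers,
     which may be arbitrary positive numbers [P] and [Q]. *)
  generalize (exp_pos (beta * ln ((1 + x) * (1 + x) + y * y))).
  generalize (exp_pos (beta * ln ((- (1) + x) * (- (1) + x) + y * y))).
  generalize (exp (beta * ln ((1 + x) * (1 + x) + y * y))).
  generalize (exp (beta * ln ((- (1) + x) * (- (1) + x) + y * y))).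
  intros Q P HQ HP. field. repeat split; lra.
Qed.

(** On the strip the metric is [|dw| ^ 2 / (16 cosh (beta x) ^ 2)], with no dependence on [y], so
    the sides have no normal derivative. *)
Lemma ebigon_geodesic_curvature (beta t : R) : sin t <> 0 ->
  geodesic_curvature (conformal (eval (ebigon 1 beta))) unit_circle t = 0.
Proof.
  intros Hs.
  assert (H1 : (cos t, sin t) <> (-1, 0)) by (intros [= _ h]; contradiction).
  assert (H2 : (cos t, sin t) <> (1, 0)) by (intros [= _ h]; contradiction).
  pose proof (ebigon_defined 1 beta _ _ H1 H2) as Hd.
  pose proof (ebigon_pos 1 beta _ _ H1 H2) as Hp.
  rewrite geodesic_curvature_unit_circle by exact Hp.
  match goal with |- ?n / _ = 0 => enough (E : n = 0) by (rewrite E; field;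
    apply Rgt_not_eq, sqrt_lt_R0, Hp) end.
  rewrite !partial_eval by exact Hd.
  apply (dist2_pos 1) in H1.
  rewrite <- (Ropp_involutive 1) in H2 at 1. apply dist2_pos in H2.
  unfold dist2 in *. clear Hd Hp.
  cbn [ebigon epower edist2 eval diff].
  pose proof (sin_sqr t) as E.
  set (s := sin t) in *. set (c := cos t) in *.
  replace ((1 + c) * (1 + c) + s * s) with (2 + 2 * c) in * by (ring [E]).
  replace ((- (1) + c) * (- (1) + c) + s * s) with (2 - 2 * c) in *
    by (ring [E]).
  generalize (exp_pos (beta * ln (2 + 2 * c))).
  generalize (exp_pos (beta * ln (2 - 2 * c))).
  generalize (exp (beta * ln (2 + 2 * c))).
  generalize (exp (beta * ln (2 - 2 * c))).
  intros Q P HQ HP. field_simplify_eq; [ring [E]|].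
  repeat split; lra.
Qed.

(** * The corners of the bigon *)

Lemma has_corner_ext (r r' : R -> R -> R) (a b alpha : R) :
  (forall x y, r x y = r' x y) -> has_corner r a b alpha ->
  has_corner r' a b alpha.
Proof.
  intros E [u [Hl Hu]]. exists u. split; [|exact Hu].
  revert Hl. apply locally_2d_impl, locally_2d_forall.
  intros x y. now rewrite <- E.
Qed.

Definition power0 (beta t : R) : R :=
  if Rle_dec t 0 then 0 else exp (beta * ln t).

Lemma power0_pos (beta t : R) : 0 < t -> power0 beta t = exp (beta * ln t).
Proof. intros H. unfold power0. destruct Rle_dec; [lra|reflexivity]. Qed.

Lemma power0_continuity (beta : R) : 0 < beta -> continuity_pt (power0 beta) 0.
Proof.
  intros Hb eps Heps. exists (exp (ln eps / beta)).
  split; [apply exp_pos|]. intros t [_ Ht]. simpl in *.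
  unfold R_dist in *. rewrite Rminus_0_r in Ht.
  replace (power0 beta 0) with 0
    by (unfold power0; destruct Rle_dec; [reflexivity|lra]).
  rewrite Rminus_0_r. unfold power0. destruct Rle_dec as [H|H].
  - now rewrite Rabs_R0.
  - rewrite Rabs_right in * by (try apply Rle_ge, Rlt_le, exp_pos; lra).
    rewrite <- (exp_ln eps Heps). apply exp_increasing.
    apply ln_increasing in Ht; [|lra]. rewrite ln_exp in Ht.
    replace (ln eps) with (beta * (ln eps / beta)) by (field; lra).
    now apply Rmult_lt_compat_l.
Qed.

(* Rocq's [ln] is total with [ln 0 = 0], so the regular factor of the metric
   needs [power0] to be continuous at the corner. *)
Definition bigon_factor (s beta x y : R) : R :=
  exp (beta * ln (dist2 s x y)) / (dist2 s x y *
    ((exp (beta * ln (dist2 s x y)) + power0 beta (dist2 (- s) x y)) *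
     (exp (beta * ln (dist2 s x y)) + power0 beta (dist2 (- s) x y)))).

Lemma power0_nonneg (beta t : R) : 0 <= power0 beta t.
Proof.
  unfold power0. destruct Rle_dec; [lra|]. apply Rlt_le, exp_pos.
Qed.

Lemma bigon_factor_pos (s beta x y : R) :
  (x, y) <> (- s, 0) -> 0 < bigon_factor s beta x y.
Proof.
  intros H. apply dist2_pos in H. unfold bigon_factor.
  pose proof (exp_pos (beta * ln (dist2 s x y))).
  pose proof (power0_nonneg beta (dist2 (- s) x y)).
  apply Rdiv_lt_0_compat; [assumption|].
  repeat apply Rmult_lt_0_compat; lra.
Qed.

Lemma dist2_continuity (s x y : R) : continuity_2d_pt (dist2 s) x y.
Proof. unfold dist2. contstrip. Qed.

Lemma bigon_factor_continuity (s beta : R) : 0 < beta -> s <> 0 ->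
  continuity_2d_pt (bigon_factor s beta) s 0.
Proof.
  intros Hb Hs.
  assert (Hn : (s, 0) <> (- s, 0)) by (intros [= h]; lra).
  pose proof (dist2_pos s s 0 Hn) as Hp.
  pose proof (exp_pos (beta * ln (dist2 s s 0))).
  pose proof (power0_nonneg beta (dist2 (- s) s 0)).
  pose proof (dist2_continuity s s 0) as C1.
  pose proof (continuity_2d_pt_ln _ _ _ C1 Hp) as C2.
  assert (C3 : continuity_2d_pt (fun x y => power0 beta (dist2 (- s) x y)) s 0).
  { apply (continuity_1d_2d_pt_comp (power0 beta)); [|apply dist2_continuity].
    replace (dist2 (- s) s 0) with 0 by (unfold dist2; ring).
    now apply power0_continuity. }
  assert (C4 : continuity_2d_pt (fun x y => exp (beta * ln (dist2 s x y))) s 0).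
  { apply continuity_2d_pt_exp. contstrip. }
  unfold bigon_factor, Rdiv. contstrip.
  repeat apply Rmult_integral_contrapositive_currified; lra.
Qed.

(** With [B = |z - s| ^ 2] and [Q = B ^ (alpha + 1)], the quotient [Q / B] is the required power
    [|z - s| ^ (2 alpha)]; the remaining factor is positive and continuous at the corner, and half
    its logarithm serves as [u]. *)
Lemma ebigon_has_corner (s alpha : R) : s * s = 1 -> alpha > -1 ->
  has_corner (eval (ebigon s (alpha + 1))) s 0 alpha.
Proof.
  intros Hs Ha. set (beta := alpha + 1). assert (Hb : 0 < beta)
    by (unfold beta; lra).
  assert (Hs0 : s <> 0) by (intros ->; lra).
  assert (Hn : (s, 0) <> (- s, 0)) by (intros [= h]; lra).
  exists (fun x y => / 2 * ln (bigon_factor s beta x y)). split.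
  - assert (Hl : locally_2d (fun x y => 0 < dist2 s x y) s 0).
    { apply continuity_2d_pt_pos; [apply dist2_continuity|].
      now apply dist2_pos. }
    revert Hl. apply locally_2d_impl, locally_2d_forall.
    intros x y HA _ Hxy.
    assert (Hxy' : (x, y) <> (- s, 0)).
    { intros [= -> ->]. unfold dist2 in HA. lra. }
    assert (HB : 0 < dist2 (- s) x y)
      by (apply dist2_pos; now rewrite Ropp_involutive).
    split.
    (* This is [u] with [power0] replaced by the plain power, which agrees with it where
       [dist2 (- s)] is positive. *)
    + pose (e := EMul (ECst (/ 2)) (ELn (EMul (epower beta (edist2 s))
        (EInv (EMul (edist2 s)
          (EMul (EAdd (epower beta (edist2 s)) (epower beta (edist2 (- s))))
            (EAdd (epower beta (edist2 s))
               (epower beta (edist2 (- s)))))))))).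
      assert (He : smooth_at (eval e) x y).
      { apply eval_smooth_at. simpl.
        fold (dist2 s x y) (dist2 (- s) x y).
        pose proof (exp_pos (beta * ln (dist2 s x y))).
        pose proof (exp_pos (beta * ln (dist2 (- s) x y))).
        repeat split; try assumption.
        - repeat apply Rmult_lt_0_compat; lra.
        - apply Rmult_lt_0_compat; [assumption|]. apply Rinv_0_lt_compat.
          repeat apply Rmult_lt_0_compat; lra. }
      (* Smoothness at a point speaks of all nearby points, and at each of these the two formulas
         must agree on a whole neighbourhood. *)
      assert (HBl : locally_2d (fun u v => locally_2d (fun u v =>
        0 < dist2 (- s) u v) u v) x y).
      { apply (locally_2d_impl (fun u v => 0 < dist2 (- s) u v)).
        - apply locally_2d_forall. intros u v h.
          apply continuity_2d_pt_pos; [apply dist2_continuity|exact h].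
        - apply continuity_2d_pt_pos; [apply dist2_continuity|exact HB]. }
      revert He. unfold smooth_at. apply locally_2d_impl. revert HBl.
      apply locally_2d_impl, locally_2d_forall. intros u v Huv H n.
      apply (ex_diff_n_ext_loc (eval e)); [|apply H].
      revert Huv. apply locally_2d_impl, locally_2d_forall. intros u' v' h.
      unfold bigon_factor. rewrite power0_pos by exact h. reflexivity.
    + pose proof (bigon_factor_pos s beta x y Hxy') as Hp.
      replace (2 * (/ 2 * ln (bigon_factor s beta x y)))
        with (ln (bigon_factor s beta x y)) by field.
      rewrite exp_ln by exact Hp.
      unfold bigon_factor. rewrite power0_pos by exact HB.
      assert (ED : dist_euc x y s 0 = sqrt (dist2 (- s) x y)).
      { unfold dist_euc, dist2, Rsqr. f_equal. ring. }
      assert (EQ : exp (beta * ln (dist2 (- s) x y))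
        = Rpower (dist_euc x y s 0) (2 * alpha) * dist2 (- s) x y).
      { rewrite ED, <- Rpower_sqrt by exact HB.
        rewrite <- (exp_ln (dist2 (- s) x y)) at 3 by exact HB.
        rewrite Rpower_mult. unfold Rpower. rewrite <- exp_plus.
        f_equal. unfold beta. field. }
      change (eval (ebigon s beta) x y) with
        (exp (beta * ln (dist2 s x y)) * exp (beta * ln (dist2 (- s) x y))
         * / (dist2 s x y * dist2 (- s) x y *
          ((exp (beta * ln (dist2 s x y)) + exp (beta * ln (dist2 (- s) x y)))
         * (exp (beta * ln (dist2 s x y))
            + exp (beta * ln (dist2 (- s) x y)))))).
      rewrite EQ at 1.
      pose proof (exp_pos (beta * ln (dist2 s x y))).
      pose proof (exp_pos (beta * ln (dist2 (- s) x y))).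
      field. repeat split; lra.
  - eapply filterlim_filter_le_1; [apply filter_le_within|].
    apply (proj1 (continuity_2d_pt_filterlim
      (fun x y => / 2 * ln (bigon_factor s beta x y)) s 0)).
    apply continuity_2d_pt_mult; [apply continuity_2d_pt_const|].
    apply continuity_2d_pt_ln.
    + now apply bigon_factor_continuity.
    + now apply bigon_factor_pos.
Qed.

(** The formula is symmetric in its two distances, so the analysis at the corner [(s, 0)] also
    covers the opposite one. *)
Lemma ebigon_opp (s beta x y : R) :
  eval (ebigon (- s) beta) x y = eval (ebigon s beta) x y.
Proof.
  cbn [ebigon epower edist2 eval]. rewrite Ropp_involutive.
  set (P := exp (beta * ln ((s + x) * (s + x) + y * y))).
  set (Q := exp (beta * ln ((- s + x) * (- s + x) + y * y))).
  f_equal; [|f_equal]; ring.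
Qed.

Theorem theorem1p1 (alpha1 alpha2 : R)
    (halpha1 : alpha1 > -1) (halpha2 : alpha2 > -1) :
  (exists rho : R -> R -> R,
      regular_away_from_corners rho /\
      (exists K : R, forall x y : R, disk x y ->
         gauss_curvature (conformal rho) x y = K) /\
      (exists kp : R, forall t : R, Gamma_plus (cos t) (sin t) ->
         geodesic_curvature (conformal rho) unit_circle t = kp) /\
      (exists km : R, forall t : R, Gamma_minus (cos t) (sin t) ->
         geodesic_curvature (conformal rho) unit_circle t = km) /\
      has_corner rho 1 0 alpha1 /\
      has_corner rho (-1) 0 alpha2)
  <-> alpha1 = alpha2.
Proof.
  split.
  - intros [r (Hr & [K HK] & [kp Hkp] & [km Hkm] & Hc1 & Hc2)].
    now apply (corner_orders_eq r alpha1 alpha2 K kp km).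
  - intros <-. exists (eval (ebigon 1 (alpha1 + 1))).
    split; [|split; [|split; [|split; [|split]]]].
    + intros x y _ H1 H2. split; [now apply ebigon_pos|].
      now apply eval_smooth_at, ebigon_defined.
    + exists (16 * (alpha1 + 1) ^ 2). intros x y Hd. unfold disk in Hd.
      apply ebigon_gauss_curvature; intros [= -> ->]; lra.
    + exists 0. intros t [_ Ht]. apply ebigon_geodesic_curvature. lra.
    + exists 0. intros t [_ Ht]. apply ebigon_geodesic_curvature. lra.
    + apply ebigon_has_corner; [ring|exact halpha1].
    + apply (has_corner_ext (eval (ebigon (-1) (alpha1 + 1)))).
      * intros x y. exact (ebigon_opp 1 (alpha1 + 1) x y).
      * apply ebigon_has_corner; [ring|exact halpha1].
Qed.
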